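(* Let $A=A(\Gamma)$ be the right angled Artin group associated to a finite simplicial graph $\Gamma$ with vertex set $V$. Let $F$ be a subgroup of $A$, and let $t \in A$ be an element such that $\mathrm{Pc}_\Gamma(G)=A$, where $G= \langle F,t \rangle \leqslant A$. Suppose that $N= \mathrm{C}_F(t)$ is a normal subgroup of $F$. Then: (i) $\mathrm{Pc}_\Gamma(N)$ is a direct factor of $A$. More precisely, $\mathrm{Pc}_\Gamma(N)=A_X$ for some $X \subseteq V$, and $V=X \sqcup \mathrm{link}_\Gamma(X)$. (ii) With $X$ as in (i), $F \cap A_X=N$, hence $F/N$ embeds into $A_Y \leqslant A$, where $Y = V \setminus X=\mathrm{link}_\Gamma(X)$.
   Context: For a finite simplicial graph $\Gamma$ with vertex set $V$ and edge set $E$, $A(\Gamma)=\langle V \mid [u,v]=1 \text{ for all } \{u,v\}\in E\rangle$. For $v\in V$, $\mathrm{link}_\Gamma(v)$ is the set of vertices adjacent to $v$ (not including $v$), and for $U \subseteq V$, $\mathrm{link}_\Gamma(U)=\bigcap_{u\in U}\mathrm{link}_\Gamma(u)$ (so $\mathrm{link}_\Gamma(\emptyset)=V$). For $U\subseteq V$, $A_U\leqslant A$ is the subgroup generated by $U$ (a full subgroup). A parabolic subgroup of $A$ is any conjugate of a full subgroup. Every subset $M\subseteq A$ is contained in a unique minimal (with respect to inclusion) parabolic subgroup of $A$, denoted $\mathrm{Pc}_\Gamma(M)$ and called the parabolic closure of $M$. $\mathrm{C}_F(t)=\{f\in F \mid ft=tf\}$ is the centralizer of $t$ in $F$. *)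

(* Defs.v *)
From HB Require Import structures.
From mathcomp Require Import all_boot.
From mathcomp Require Import boolp classical_sets.

Set Implicit Arguments.
Unset Strict Implicit.
Unset Printing Implicit Defensive.

Local Open Scope group_scope.
Local Open Scope quotient_scope.

Record simplicialGraph := SimplicialGraph {
  vertex :> finType;
  adj : rel vertex;
  adj_sym : symmetric adj;
  adj_irr : irreflexive adj }.

(* The empty intersection is the whole vertex set, so link set0 = setT. *)
Definition link (Gam : simplicialGraph) (U : {set Gam}) : {set Gam} :=
  (\bigcap_(u in U) [set v | adj u v])%SET.

Section RAAG.
Variable Gam : simplicialGraph.

(* (v, true) stands for the letter v and (v, false) for its formal inverse. *)
Definition raag_word := seq (Gam * bool).

(* The congruence presenting <V | [u, v] = 1 for all edges {u, v}>: two words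
   are related iff they represent the same element of that group. *)
Inductive raag_eq : raag_word -> raag_word -> Prop :=
| raag_eq_refl w : raag_eq w w
| raag_eq_sym w1 w2 : raag_eq w1 w2 -> raag_eq w2 w1
| raag_eq_trans w1 w2 w3 : raag_eq w1 w2 -> raag_eq w2 w3 -> raag_eq w1 w3
| raag_eq_cat w1 w2 w3 w4 :
    raag_eq w1 w2 -> raag_eq w3 w4 -> raag_eq (w1 ++ w3) (w2 ++ w4)
| raag_eq_cancel v b : raag_eq [:: (v, b); (v, ~~ b)] [::]
| raag_eq_comm u v : adj u v ->
    raag_eq [:: (u, false); (v, false); (u, true); (v, true)] [::].

Definition raag_eqb : rel raag_word := fun w1 w2 => `[< raag_eq w1 w2 >].

Fact raag_eqb_equiv : equiv_class_of raag_eqb.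
Proof.
split=> [w|w1 w2|w2 w1 w3].
- exact/asboolP/raag_eq_refl.
- by apply/asboolP/asboolP; exact: raag_eq_sym.
- by move=> /asboolP h1 /asboolP h2; apply/asboolP/(raag_eq_trans h1 h2).
Qed.

Canonical raag_equiv := EquivRelPack raag_eqb_equiv.

Definition raag := {eq_quot raag_equiv}.
HB.instance Definition _ : EqQuotient _ raag_equiv raag := EqQuotient.on raag.
HB.instance Definition _ := Choice.on raag.

Definition raag_one : raag := \pi_raag [::].
Definition raag_mul (x y : raag) : raag := \pi_raag (repr x ++ repr y).
Definition raag_inv (x : raag) : raag :=
  \pi_raag (rev [seq (l.1, ~~ l.2) | l <- repr x]).

Lemma raag_piP (w1 w2 : raag_word) :
  \pi_raag w1 = \pi_raag w2 <-> raag_eq w1 w2.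
Proof.
split=> [/eqmodP/asboolP //|h].
by apply/eqmodP/asboolP.
Qed.

Lemma repr_raag_pi (w : raag_word) : raag_eq (repr (\pi_raag w)) w.
Proof. by apply/raag_piP; rewrite reprK. Qed.

Lemma raag_piM (w1 w2 : raag_word) :
  raag_mul (\pi_raag w1) (\pi_raag w2) = \pi_raag (w1 ++ w2).
Proof. by apply/raag_piP/raag_eq_cat; exact: repr_raag_pi. Qed.

Fact raag_mulA : associative raag_mul.
Proof.
elim/quotW=> a; elim/quotW=> b; elim/quotW=> c.
by rewrite (raag_piM b c) (raag_piM a b) !raag_piM catA.
Qed.

Fact raag_mul1 : left_id raag_one raag_mul.
Proof. by elim/quotW=> w; rewrite raag_piM. Qed.

Fact raag_mulr1 : right_id raag_one raag_mul.
Proof. by elim/quotW=> w; rewrite raag_piM cats0. Qed.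

Lemma raag_eq_catV (w : raag_word) :
  raag_eq (w ++ rev [seq (l.1, ~~ l.2) | l <- w]) [::].
Proof.
elim: w => [|[v b] w IHw]; first exact: raag_eq_refl.
rewrite map_cons rev_cons -cats1 cat_cons catA -cat1s.
apply: raag_eq_trans (raag_eq_cancel v b).
apply: (@raag_eq_cat [:: (v, b)] [:: (v, b)]); first exact: raag_eq_refl.
by apply: (@raag_eq_cat _ [::]); [exact: IHw | exact: raag_eq_refl].
Qed.

Lemma raag_word_invK (w : raag_word) :
  rev [seq (l.1, ~~ l.2) | l <- rev [seq (l.1, ~~ l.2) | l <- w]] = w.
Proof.
rewrite map_rev revK -map_comp -[RHS]map_id.
by apply: eq_map => -[v b] /=; rewrite negbK.
Qed.

Fact raag_mulV : right_inverse raag_one raag_inv raag_mul.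
Proof.
move=> x; rewrite -[X in raag_mul X _]reprK raag_piM.
exact/raag_piP/raag_eq_catV.
Qed.

Fact raag_mulVl : left_inverse raag_one raag_inv raag_mul.
Proof.
move=> x; rewrite -[X in raag_mul _ X]reprK raag_piM.
apply/raag_piP; rewrite -[X in _ ++ X]raag_word_invK.
exact: raag_eq_catV.
Qed.

HB.instance Definition _ := isGroup.Build raag
  raag_mulA raag_mul1 raag_mulr1 raag_mulVl raag_mulV.

Definition raag_gen (v : Gam) : raag := \pi_raag [:: (v, true)].

End RAAG.

Local Open Scope classical_set_scope.

Section Subgroups.
Variable A : groupType.
Implicit Types (F N P K H : set A) (M : set A).

Definition subgroup H : Prop :=
  [/\ H 1, forall x y, H x -> H y -> H (x * y) & forall x, H x -> H x^-1].

Definition generated M : set A := smallest subgroup M.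

Definition centralizer F (t : A) : set A := [set f | F f /\ f * t = t * f].

Definition normal_in N F : Prop :=
  [/\ subgroup N, N `<=` F & forall f n, F f -> N n -> N (n ^ f)].

Definition direct_factor P : Prop :=
  exists K : set A,
    [/\ subgroup P, subgroup K,
        forall x y, P x -> K y -> commute x y,
        P `&` K = [set 1]
      & forall a, exists x y, [/\ P x, K y & a = x * y]].

Definition set_mul (C D : set A) : set A := [set x * y | x in C & y in D].

(* For N normal in F, the underlying set of F / N; its group law is set_mul. *)
Definition quotient F N : set (set A) :=
  [set [set x * n | n in N] | x in F].

Definition quotient_embeds F N H : Prop :=
  exists phi : set A -> A,
    [/\ forall C, quotient F N C -> H (phi C),
        forall C D, quotient F N C -> quotient F N D ->
          phi (set_mul C D) = phi C * phi D
      & {in quotient F N &, injective phi}].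

End Subgroups.

Section Parabolic.
Variable Gam : simplicialGraph.
Local Notation A := (raag Gam).

Definition full_subgroup (U : {set Gam}) : set A :=
  generated [set raag_gen u | u in [set u | u \in U]].

Definition parabolic (P : set A) : Prop :=
  exists (U : {set Gam}) (g : A), P = [set x ^ g | x in full_subgroup U].

Definition minimal_parabolic (M P : set A) : Prop :=
  [/\ parabolic P, M `<=` P
    & forall Q, parabolic Q -> M `<=` Q -> Q `<=` P -> Q = P].

(* Definite description: the minimal parabolic subgroup containing M, provided
   there is exactly one. The default set0 is not a subgroup, so an equality
   Pc M = P with P a subgroup asserts that P is the unique minimal one. *)
Definition Pc (M : set A) : set A := xget set0 (unique (minimal_parabolic M)).

End Parabolic.

(* Main.v *)
Require Import Defs.
From HB Require Import structures.
From mathcomp Require Import all_boot.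
From mathcomp Require Import ssralg ssrnum ssrint.
From mathcomp Require Import boolp classical_sets.
From mathcomp Require Import zify.

Set Implicit Arguments.
Unset Strict Implicit.
Unset Printing Implicit Defensive.

Local Open Scope group_scope.
Local Open Scope classical_set_scope.
Local Open Scope quotient_scope.

(** Write A_U for the full subgroup of U and V for the vertex set.  The proof
has three ingredients.

Parabolic subgroups.  Killing the generators outside U defines a retraction
[rho U] of A, and A_U is its set of fixed points.  If x lies in A_U and in
A_W ^ g, applying [rho U] and [rho W] to the two expressions of x shows that the
intersection of A_U and A_W ^ g is conjugate to that of A_Z and A_Z ^ l, where Z
is the intersection of U and W.  For a vertex v outside Z, the group A is an HNN
extension of A_(V - v) with stable letter v and edge group A_(link v); an element
of A_Z and A_Z ^ l fixes the path from the base point to its image under l^-1 in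
the Bass-Serre tree of this extension.  This writes the intersection in terms
of parabolic subgroups on fewer vertices, so an induction gives
[parabolic_in_cap], and with it the existence of parabolic closures.  The same
tree shows that the normalizer of A_U lies in A_(U + link U)
([normalizer_full]).

Trees.  The tree of v is realized by an explicit action of A on reduced words in
the cosets of A_(link v); the size of the word attached to g is a Lyndon length
function.  If n is cyclically reduced of positive length, an element a of its
centralizer preserves the axis of n, and the signed translation length along
this axis is a homomorphism from the centralizer of n to the integers whose
absolute value is the length ([translation_hom]).

Rigidity.  If N lies in A_X but in no smaller parabolic subgroup, and N commutes
with s and with s ^ f, where s and f are in A_X, then s ^ f = s
([spanning_rigid]).  Splitting X as a join, one may assume that X is irreducible
and s, N nontrivial.  Then Pc {s} = A_X, and so is Pc {n} for each nontrivial n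
in N, because the parabolic closure of a set is normalized by whatever
normalizes the set.  The translation homomorphism is injective on the
centralizer of n in A_X, since an element in its kernel lies in a conjugate of
A_(V - v).  Hence this centralizer is abelian and s commutes with s ^ f.
The same homomorphism for s shows that s ^ f is s or its inverse; in the second
case f * f commutes with s and with f, which forces f * f = 1, and A has no
involution.

For the theorem, N = C_F(t) is normalized by F and by t, so Pc N is normalized
by a set that lies in no proper parabolic subgroup.  Hence Pc N = A_X with
V = X + link X and A = A_X x A_(link X).  If f is in F and A_X, let s be the
component of t in A_X.  Then N commutes with s, and with s ^ f because f
normalizes N.  Rigidity gives s ^ f = s, and f commutes with t. *)

(** * Lyndon length functions and translation lengths *)

Lemma nonincreasing_stationary (f : nat -> nat) :
  (forall k, f k.+1 <= f k) -> exists K, forall k, K <= k -> f k = f K.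
Proof.
move=> fS.
have fle i j : i <= j -> f j <= f i.
  move=> /subnK <-; elim: (j - i) => [//|d IHd].
  exact: leq_trans (fS _) IHd.
have exv : exists v, `[< exists k, f k = v >].
  by exists (f 0); apply/asboolP; exists 0.
case: (ex_minnP exv) => v /asboolP[K fK] vmin.
exists K => k leKk; apply/eqP; rewrite eqn_leq fle //= fK.
by apply: vmin; apply/asboolP; exists k.
Qed.

(** For g acting on a tree with base point p, [L g] is the distance from p to
g p, so this is the distance between x p and y p. *)
Definition length_dist (G : groupType) (L : G -> nat) (x y : G) : nat :=
  L (x^-1 * y).

(** Lyndon's axioms; the last one is the four-point condition that
characterizes the metrics of trees. *)
Record lyndon_length (G : groupType) (L : G -> nat) : Prop := LyndonLength {
  lyndon1 : L 1 = 0;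
  lyndonV : forall x, L x^-1 = L x;
  lyndon4 : forall x y z w,
    length_dist L x y + length_dist L z w <=
      maxn (length_dist L x z + length_dist L y w)
           (length_dist L x w + length_dist L y z) }.

Section Translation.
Variables (G : groupType) (L : G -> nat).
Hypothesis HL : lyndon_length L.

Local Notation dist := (length_dist L).

Lemma length_distC x y : dist x y = dist y x.
Proof. by rewrite /length_dist -[LHS](lyndonV HL) invgM invgK. Qed.

Lemma lyndonM x y : L (x * y) <= L x + L y.
Proof.
have dE z : L z = dist 1 z by rewrite /length_dist invg1 mul1g.
have dxx : dist x x = 0 by rewrite /length_dist mulVg lyndon1.
have dy : dist (x * y) x = L y by rewrite length_distC /length_dist mulKg.
by have := lyndon4 HL 1 (x * y) x x; rewrite dxx dy -!dE addn0 maxnn.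
Qed.

(** The condition [Ln] says that the base point lies on the axis of n, which is
translated by m. *)
Variables (n : G) (m : nat).
Hypotheses (m_gt0 : 0 < m) (Ln : forall k, L (n ^+ k) = (k * m)%N).

(** The value at a of the Busemann function of the end to which the powers of n
converge; for a in the centralizer of n this is the signed translation length
of a along the axis of n. *)
Definition busemann (a : G) : set int :=
  fun c => exists K, forall k, K <= k -> Posz (L (n ^+ k * a)) = (Posz (k * m) + c)%R.

(** The differences [L (n ^+ k * a) - k * m] are nonincreasing in k and at least
[- L a], so they stabilize. *)
Lemma busemann_ex a : exists c, busemann a c.
Proof.
have lowL k : k * m <= L (n ^+ k * a) + L a.
  by rewrite -Ln -(lyndonV HL a) -{1}(mulgK a (n ^+ k)) lyndonM.
have stepL k : L (n ^+ k.+1 * a) <= m + L (n ^+ k * a).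
  have <- : L n = m by have := Ln 1; rewrite mul1n.
  by rewrite expgS -mulgA lyndonM.
have [k|K HK] := @nonincreasing_stationary (fun k => L (n ^+ k * a) + L a - k * m).
  by have := lowL k; have := stepL k; lia.
exists (Posz (L (n ^+ K * a)%g + L a - K * m)%N - Posz (L a))%R.
exists K => k leKk.
by have := HK k leKk; have := lowL k; have := lowL K; lia.
Qed.

(** Both claims are instances of the four-point condition.  Far along the axis,
the points 1, N, a, N * a force the Busemann values of a and a^-1 to be
opposite; the points N^-1, N, 1, a then place a on the axis, at distance [|c|]
from 1. *)
Lemma busemannV a c : commute n a -> busemann a c ->
  busemann a^-1 (- c)%R /\ L a = absz c.
Proof.
move=> na ac; have [c' a'c'] := busemann_ex a^-1.
case: ac => K HK; case: (a'c') => K' HK'.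
pose P := (K + K' + (L a).+1)%N; pose N := n ^+ P.
have {HK} DP : Posz (L (N * a)) = (Posz (P * m) + c)%R by apply: HK; lia.
have {HK'} DV : Posz (L (N * a^-1)) = (Posz (P * m) + c')%R by apply: HK'; lia.
have Na : commute a N by exact/commuteX/commute_sym.
have LN : L N = (P * m)%N by exact: Ln.
have LNN : L (N * N) = (P * m + P * m)%N by rewrite /N -expgnDr Ln mulnDl.
have LP : L a < P * m by rewrite /P; nia.
have NaV : L (N^-1 * a) = L (N * a^-1).
  by rewrite -(lyndonV HL) invgM invgK; congr L; apply/commute_sym/commuteV/commute_sym.
have d1 x : dist 1 x = L x by rewrite /length_dist invg1 mul1g.
have d2 : dist a (N * a) = L N by rewrite /length_dist -Na mulKg.
have d3 : dist N (N * a) = L a by rewrite /length_dist mulKg.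
have d4 : dist N a = L (N * a^-1) by rewrite /length_dist NaV.
have c'E : c' = (- c)%R.
  have := lyndon4 HL 1 N a (N * a); have := lyndon4 HL 1 (N * a) N a.
  rewrite (length_distC (N * a) N) (length_distC (N * a) a) !d1 d2 d3 d4; lia.
split; first by rewrite -c'E.
have e1 : dist N^-1 N = (P * m + P * m)%N by rewrite /length_dist invgK.
have e2 : dist N^-1 1 = (P * m)%N by rewrite length_distC d1 (lyndonV HL).
have e3 : dist N^-1 a = L (N * a) by rewrite /length_dist invgK.
have := lyndon4 HL N^-1 N 1 a; have := lyndon4 HL N^-1 a N 1.
have := lyndon4 HL N^-1 1 N a.
rewrite e1 e2 e3 !(length_distC _ 1) !(length_distC a) !d1 d4; lia.
Qed.

(** The triangle inequality along the factorization
[n ^+ (P + P) * (a * b) = n ^+ P * a * (n ^+ P * b)]. *)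
Lemma busemannM a b c d e : commute n a -> commute n b ->
  busemann a c -> busemann b d -> busemann (a * b) e -> (e <= c + d)%R.
Proof.
move=> na nb [Ka Ha] [Kb Hb] [K HK].
pose P := (Ka + Kb + K)%N.
have := Ha P; have := Hb P; have := HK (P + P)%N.
suff : L (n ^+ (P + P) * (a * b)) <= L (n ^+ P * a) + L (n ^+ P * b) by lia.
have -> : n ^+ (P + P) * (a * b) = n ^+ P * a * (n ^+ P * b).
  rewrite expgnDr -!mulgA; congr (_ * _); rewrite !mulgA; congr (_ * _).
  exact/commute_sym/commuteX/commute_sym.
exact: lyndonM.
Qed.

(** Busemann values are subadditive on a, b and on their inverses, whose values
are opposite. *)
Theorem translation_hom : exists tau : G -> int,
  (forall a b, commute n a -> commute n b -> tau (a * b) = (tau a + tau b)%R) /\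
  (forall a, commute n a -> L a = absz (tau a)).
Proof.
exists (fun a => xget 0%R (busemann a)).
have tauP a : busemann a (xget 0%R (busemann a)) by apply: xgetPex; exact: busemann_ex.
split=> [a b na nb|a na]; last exact: (busemannV na (tauP a)).2.
have nab := commuteM na nb.
have := busemannM na nb (tauP a) (tauP b) (tauP _).
have := (busemannV nab (tauP (a * b))).1; rewrite invgM => abV.
have [aV _] := busemannV na (tauP a); have [bV _] := busemannV nb (tauP b).
have := busemannM (commuteV nb) (commuteV na) bV aV abV; lia.
Qed.
End Translation.

(** An orbit that does not backtrack after one step never does: local geodesics
of a tree are geodesics. *)
Lemma lyndon_pow (G : groupType) (L : G -> nat) n : lyndon_length L ->
  0 < L n -> L (n * n) = (L n + L n)%N -> forall k, L (n ^+ k) = (k * L n)%N.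
Proof.
move=> HL n_gt0 L2; suff Lk k : L (n ^+ k) = (k * L n)%N /\ L (n ^+ k.+1) = (k.+1 * L n)%N.
  by move=> k; case: (Lk k).
elim: k => [|k [IH0 IH1]]; first by rewrite expg1 mul1n (lyndon1 HL).
split=> //; case: k => [|k] in IH0 IH1 *; first by rewrite L2 mulSn mul1n.
have dE x y : length_dist L x (x * y) = L y by rewrite /length_dist mulKg.
have dE1 y : length_dist L 1 y = L y by rewrite -{1}[y]mul1g dE.
have d1 : length_dist L n (n ^+ k.+2) = L (n ^+ k.+1) by rewrite expgS dE.
have d2 : length_dist L n (n ^+ k.+3) = L (n ^+ k.+2) by rewrite expgS dE.
have d3 : length_dist L (n ^+ k.+2) (n ^+ k.+3) = L n by rewrite [n ^+ k.+3]expgSr dE.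
have dC x y : length_dist L x y = length_dist L y x by exact: length_distC.
have := lyndon4 HL 1 (n ^+ k.+2) n (n ^+ k.+3).
have := lyndon4 HL 1 (n ^+ k.+3) n (n ^+ k.+2).
rewrite (dC (n ^+ k.+2) n) (dC (n ^+ k.+3) n) (dC (n ^+ k.+3)) !dE1 d1 d2 d3 IH0 IH1 !mulSn; lia.
Qed.

Lemma lyndon_conj (G : groupType) (L : G -> nat) h : lyndon_length L ->
  lyndon_length (fun x => L (x ^ h)).
Proof.
move=> HL; split=> [|x|x y z w]; first by rewrite conj1g (lyndon1 HL).
  by rewrite conjVg (lyndonV HL).
rewrite /length_dist !conjMg !conjVg.
exact: (lyndon4 HL (x ^ h) (y ^ h) (z ^ h) (w ^ h)).
Qed.

(** * The tree of finite sequences *)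

Section SeqTree.
Variable T : eqType.
Implicit Types p q r : seq T.

Fixpoint lcp p q : nat :=
  match p, q with
  | a :: p', b :: q' => if a == b then (lcp p' q').+1 else 0
  | _, _ => 0
  end.

Definition tree_dist p q : nat := size p + size q - (lcp p q).*2.

Lemma lcp_le p q : (lcp p q <= size p) && (lcp p q <= size q).
Proof.
by elim: p q => [|a p IHp] [|b q] //=; case: eqP => // _; exact: (IHp q).
Qed.

Lemma lcpC p q : lcp p q = lcp q p.
Proof. by elim: p q => [|a p IHp] [|b q] //=; rewrite eq_sym IHp. Qed.

Lemma lcp_ultra q p r : minn (lcp p q) (lcp q r) <= lcp p r.
Proof.
elim: p q r => [|a p IHp] [|b q] [|c r] //=; rewrite ?minn0 ?min0n //.
case: eqP => [<-|_]; last by rewrite min0n.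
by case: eqP => // _; rewrite minnSS ltnS IHp.
Qed.

Lemma tree_distC p q : tree_dist p q = tree_dist q p.
Proof. by rewrite /tree_dist addnC lcpC. Qed.

Lemma tree_distE p q : tree_dist p q + (lcp p q).*2 = size p + size q.
Proof. by rewrite /tree_dist; have := lcp_le p q; lia. Qed.

(** The longest common prefix is ultrametric, and the four-point condition is
what this becomes for distances. *)
Lemma tree_dist4 p q r s :
  tree_dist p q + tree_dist r s <=
    maxn (tree_dist p r + tree_dist q s) (tree_dist p s + tree_dist q r).
Proof.
have lcp4 : minn (lcp p r + lcp q s) (lcp p s + lcp q r) <= lcp p q + lcp r s.
  have := lcp_ultra r p q; have := lcp_ultra s p q.
  have := lcp_ultra p r s; have := lcp_ultra q r s.
  rewrite (lcpC r p) (lcpC r q) (lcpC s q).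
  lia.
have := tree_distE p q; have := tree_distE r s; have := tree_distE p r.
have := tree_distE q s; have := tree_distE p s; have := tree_distE q r.
lia.
Qed.
End SeqTree.

(** * Retractions onto full subgroups *)

Section Retraction.
Variable Gam : simplicialGraph.
Local Notation A := (raag Gam).
Implicit Types (U W X Z : {set Gam}) (g h x y : A) (w : raag_word Gam).

Definition raag_letter (l : Gam * bool) : A := \pi_A [:: l].

Lemma pi_cons l w : \pi_A (l :: w) = raag_letter l * \pi_A w.
Proof. exact/esym/(raag_piM [:: l] w). Qed.

Lemma raag_ind (P : A -> Prop) :
  P 1 -> (forall l g, P g -> P (raag_letter l * g)) -> forall g, P g.
Proof.
move=> P1 PM; elim/quotW; elim=> [|l w IHw]; first exact: P1.
by rewrite pi_cons; apply: PM.
Qed.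

Lemma raag_letterV v b : raag_letter (v, ~~ b) = (raag_letter (v, b))^-1.
Proof.
apply/esym/mulg1_eq; rewrite /raag_letter [LHS]raag_piM.
exact/raag_piP/raag_eq_cancel.
Qed.

Lemma raag_letterE v b : raag_letter (v, b) = if b then raag_gen v else (raag_gen v)^-1.
Proof. by case: b => //; rewrite -[false]/(~~ true) raag_letterV. Qed.

Lemma raag_letter_commute u v b c : adj u v ->
  commute (raag_letter (u, b)) (raag_letter (v, c)).
Proof.
move=> uv.
have gens : commute (raag_gen u) (raag_gen v).
  have /raag_piP := raag_eq_comm uv.
  rewrite !pi_cons !raag_letterE -[\pi_A [::]]/(1 : A) mulg1 => uv1.
  exact/commgP/eqP.
rewrite !raag_letterE; case: b; case: c => //.
- exact: commuteV.
- exact/commute_sym/commuteV/commute_sym.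
- by apply/commuteV/commute_sym/commuteV/commute_sym.
Qed.

(** Deleting the letters outside U respects the defining relations. *)
Definition rho U g : A := \pi_A [seq l <- repr g | l.1 \in U].

Lemma raag_eq_filter U w1 w2 : raag_eq w1 w2 ->
  raag_eq [seq l <- w1 | l.1 \in U] [seq l <- w2 | l.1 \in U].
Proof.
elim=> {w1 w2} [w|w1 w2 _|w1 w2 w3 _ h12 _|w1 w2 w3 w4 _ h1 _ h2|v b|u v uv] /=.
- exact: raag_eq_refl.
- exact: raag_eq_sym.
- exact: raag_eq_trans.
- by rewrite !filter_cat; apply: raag_eq_cat.
- by case: (v \in U); [exact: raag_eq_cancel | exact: raag_eq_refl].
- case: (u \in U); case: (v \in U).
  + exact: raag_eq_comm.
  + exact: (raag_eq_cancel u false).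
  + exact: (raag_eq_cancel v false).
  + exact: raag_eq_refl.
Qed.

Lemma rho_pi U w : rho U (\pi_A w) = \pi_A [seq l <- w | l.1 \in U].
Proof. exact/raag_piP/raag_eq_filter/repr_raag_pi. Qed.

Lemma rho1 U : rho U 1 = 1.
Proof. exact: (rho_pi U [::]). Qed.

Lemma rhoM U g h : rho U (g * h) = rho U g * rho U h.
Proof.
elim/quotW: g => w1; elim/quotW: h => w2.
by rewrite [_ * _ in LHS]raag_piM !rho_pi filter_cat [RHS]raag_piM.
Qed.

Lemma rhoV U g : rho U g^-1 = (rho U g)^-1.
Proof. by apply/esym/mulg1_eq; rewrite -rhoM mulgV rho1. Qed.

Lemma rhoJ U g h : rho U (g ^ h) = rho U g ^ rho U h.
Proof. by rewrite !conjgE !rhoM rhoV. Qed.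

Lemma rho_rho U W g : rho U (rho W g) = rho (U :&: W) g.
Proof.
elim/quotW: g => w; rewrite (rho_pi W) (rho_pi U) (rho_pi (U :&: W)) -filter_predI.
congr (\pi_A _); apply: eq_filter => l.
by rewrite /= finset.in_setI.
Qed.

Lemma rhoT g : rho finset.setT g = g.
Proof.
elim/quotW: g => w; rewrite rho_pi (eq_filter (a2 := predT)) ?filter_predT //.
by move=> l; rewrite /= finset.in_setT.
Qed.

Lemma rho0 g : rho finset.set0 g = 1.
Proof.
elim/quotW: g => w; rewrite rho_pi (eq_filter (a2 := pred0)) ?filter_pred0 //.
by move=> l; rewrite /= finset.in_set0.
Qed.

Lemma rho_letter U l :
  rho U (raag_letter l) = if l.1 \in U then raag_letter l else 1.
Proof. by rewrite rho_pi /=; case: ifP. Qed.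

Lemma rho_gen U v : rho U (raag_gen v) = if v \in U then raag_gen v else 1.
Proof. exact: rho_letter. Qed.

Lemma generated_subgroup (G : groupType) (M : set G) : subgroup (generated M).
Proof.
split=> [H [[]] //|x y Hx Hy H [sgH MH]|x Hx H [sgH MH]].
- by case: (sgH) => _ HM _; apply: HM; [apply: Hx | apply: Hy].
- by case: (sgH) => _ _ HV; apply: HV; apply: Hx.
Qed.

(** This turns membership in a full subgroup into an equation, to which
homomorphisms can be applied. *)
Lemma full_subgroupP U g : full_subgroup U g <-> rho U g = g.
Proof.
split=> [Ug|<-].
  apply: (Ug [set x | rho U x = x]); split=> [|_ [u /= uU <-]]; last first.
    by rewrite /= rho_gen uU.
  split=> /= [|x y xU yU|x xU]; first exact: rho1.
    by rewrite rhoM xU yU.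
  by rewrite rhoV xU.
elim/quotW: g => w; rewrite rho_pi.
have [sg1 sgM sgV] : subgroup (full_subgroup U) by exact: generated_subgroup.
elim: w => [|[v b] w IHw] /=; first exact: sg1.
case: ifP => // vU; rewrite pi_cons; apply: sgM => //.
have vg : full_subgroup U (raag_gen v).
  by apply: sub_gen_smallest; exists v.
by rewrite raag_letterE; case: (b) => //; apply: sgV.
Qed.

Lemma full_subgroup1 U : full_subgroup U 1.
Proof. exact/full_subgroupP/rho1. Qed.

Lemma full_subgroupM U x y :
  full_subgroup U x -> full_subgroup U y -> full_subgroup U (x * y).
Proof. by move=> /full_subgroupP xU /full_subgroupP yU; apply/full_subgroupP; rewrite rhoM xU yU. Qed.

Lemma full_subgroupV U x : full_subgroup U x -> full_subgroup U x^-1.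
Proof. by move=> /full_subgroupP xU; apply/full_subgroupP; rewrite rhoV xU. Qed.

Lemma full_subgroupJ U x y :
  full_subgroup U x -> full_subgroup U y -> full_subgroup U (x ^ y).
Proof. by move=> /full_subgroupP xU /full_subgroupP yU; apply/full_subgroupP; rewrite rhoJ xU yU. Qed.

Lemma full_subgroupS U W : U \subset W -> full_subgroup U `<=` full_subgroup W.
Proof.
move=> UW g /full_subgroupP gU; apply/full_subgroupP.
by rewrite -gU rho_rho (finset.setIidPr UW).
Qed.

Lemma rho_full U W g : full_subgroup W g -> full_subgroup (U :&: W) (rho U g).
Proof.
move=> /full_subgroupP gW; apply/full_subgroupP; rewrite rho_rho -gW.
by rewrite !rho_rho; congr rho; apply/finset.setP => z; rewrite !inE; case: (z \in U); case: (z \in W).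
Qed.

Lemma rho_in U g : full_subgroup U (rho U g).
Proof. by apply/full_subgroupP; rewrite rho_rho finset.setIid. Qed.

Lemma full_subgroupI U W g : full_subgroup U g -> full_subgroup W g ->
  full_subgroup (U :&: W) g.
Proof. by move=> Ug Wg; rewrite -[g](iffLR (full_subgroupP U g)) //; apply: rho_full. Qed.

Lemma full_subgroup_ind U (P : A -> Prop) : P 1 ->
  (forall l g, l.1 \in U -> P g -> P (raag_letter l * g)) ->
  forall g, full_subgroup U g -> P g.
Proof.
move=> P1 PM g /full_subgroupP <-; elim/quotW: g => w; rewrite rho_pi.
elim: w => [|l w IHw] /=; first exact: P1.
by case: ifP => // lU; rewrite pi_cons; apply: PM.
Qed.

Lemma full_subgroup_commute U W x y :
  (forall u v, u \in U -> v \in W -> adj u v) ->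
  full_subgroup U x -> full_subgroup W y -> commute x y.
Proof.
move=> UW Ux; move: y; apply: full_subgroup_ind => [|[w c] y wW xy].
  exact: commute1.
apply: commuteM => //; apply/commute_sym.
move: x Ux {xy}; apply: full_subgroup_ind => [|[u b] x uU xw].
  exact: commute1.
by apply: commuteM => //; apply/commute_sym/raag_letter_commute/UW.
Qed.

End Retraction.

(** * The Bass-Serre tree attached to a vertex *)

(** A is an HNN extension of [base_group] with stable letter v and associated
subgroup [edge_group], the identity being the attaching map.  A vertex of its
Bass-Serre tree is encoded by the path that leads to it from the base point,
namely a reduced word in the free group on the left cosets of [edge_group] in
[base_group]: the kernel of the retraction onto [base_group] is free on the
conjugates of v, which these cosets index. *)
Section Tree.
Variables (Gam : simplicialGraph) (v : Gam).
Local Notation A := (raag Gam).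
Implicit Types (U W X Z : {set Gam}) (g h x y b : A) (w : raag_word Gam).
Implicit Types (e : set A * bool) (p q : seq (set A * bool)).

Definition nbrs : {set Gam} := finset (adj v).
Definition edge_group : set A := full_subgroup nbrs.
Definition ltrans g (s : set A) : set A := [set g * x | x in s].
Definition edge_trans g e := (ltrans g e.1, e.2).
Definition edge_flip e := (e.1, ~~ e.2).

Definition push e p :=
  if p is e' :: p' then if e' == edge_flip e then p' else e :: p else [:: e].

(** The vertex group permutes the cosets by left translation, and v multiplies
the word by the free generator attached to the trivial coset. *)
Definition letter_act (l : Gam * bool) p :=
  if l.1 == v then push (edge_group, l.2) p else map (edge_trans (raag_letter l)) p.

Definition word_act w p := foldr letter_act p w.

Definition reduced p := sorted (fun e e' => e' != edge_flip e) p.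

Lemma word_act_cat w1 w2 p : word_act (w1 ++ w2) p = word_act w1 (word_act w2 p).
Proof. exact: foldr_cat. Qed.

Lemma edge_flipK : involutive edge_flip.
Proof. by case=> s c; rewrite /edge_flip /= negbK. Qed.

Lemma ltrans1 (s : set A) : ltrans 1 s = s.
Proof.
by apply/seteqP; split=> [_ [x sx <-]|x sx]; [rewrite mul1g | exists x; rewrite ?mul1g].
Qed.

Lemma ltransM g h (s : set A) : ltrans (g * h) s = ltrans g (ltrans h s).
Proof.
apply/seteqP; split=> [_ [x sx <-]|_ [_ [x sx <-] <-]].
  by exists (h * x); [exists x | rewrite mulgA].
by exists x; rewrite ?mulgA.
Qed.

Lemma edge_trans1 e : edge_trans 1 e = e.
Proof. by case: e => s c; rewrite /edge_trans ltrans1. Qed.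

Lemma edge_transM g h e : edge_trans (g * h) e = edge_trans g (edge_trans h e).
Proof. by rewrite /edge_trans /= ltransM. Qed.

Lemma edge_trans_inj g : injective (edge_trans g).
Proof.
by apply: (can_inj (g := edge_trans g^-1)) => e; rewrite -edge_transM mulVg edge_trans1.
Qed.

Lemma ltrans_full U g : full_subgroup U g -> ltrans g (full_subgroup U) = full_subgroup U.
Proof.
move=> Ug; apply/seteqP; split=> [_ [x Ux <-]|x Ux]; first exact: full_subgroupM.
exists (g^-1 * x); last by rewrite mulVKg.
by apply: full_subgroupM => //; apply: full_subgroupV.
Qed.

Lemma push_reduced e p : reduced p -> reduced (push e p).
Proof.
rewrite /push; case: p => [|e' p] //= pr; case: eqP => [_|/eqP ne].
  by move: pr; apply: path_sorted.
by rewrite /= ne.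
Qed.

Lemma pushK e p : reduced p -> push e (push (edge_flip e) p) = p.
Proof.
rewrite /push; case: p => [|e' p] /=; first by rewrite eqxx.
rewrite edge_flipK; case: eqP => [-> |_ _]; last by rewrite eqxx.
by case: p => [|e'' p] //= /andP[/negPf ->].
Qed.

Lemma map_push g e p :
  map (edge_trans g) (push e p) = push (edge_trans g e) (map (edge_trans g) p).
Proof.
case: p => [|e' p] //=.
rewrite -[edge_flip (edge_trans g e)]/(edge_trans g (edge_flip e)).
by rewrite (inj_eq (@edge_trans_inj g)); case: ifP.
Qed.

Lemma map_reduced g p : reduced (map (edge_trans g) p) = reduced p.
Proof.
rewrite /reduced sorted_map; apply: eq_sorted => e e' /=.
by rewrite -[edge_flip (edge_trans g e)]/(edge_trans g (edge_flip e))
  (inj_eq (@edge_trans_inj g)).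
Qed.

Lemma letter_act_reduced l p : reduced p -> reduced (letter_act l p).
Proof.
by rewrite /letter_act; case: ifP => _ pr; rewrite ?map_reduced //; exact: push_reduced.
Qed.

Lemma word_act_reduced w p : reduced p -> reduced (word_act w p).
Proof. by move=> pr; elim: w => //= l w; apply: letter_act_reduced. Qed.

Lemma letter_actK u c p : reduced p -> letter_act (u, c) (letter_act (u, ~~ c) p) = p.
Proof.
rewrite /letter_act /=; case: (u == v) => pr.
  by rewrite -[(edge_group, ~~ c)]/(edge_flip (edge_group, c)) pushK.
rewrite -map_comp -[RHS]map_id; apply: eq_map => e /=.
by rewrite -edge_transM raag_letterV mulgV edge_trans1.
Qed.

(** The only case that is not plain commutation of translations is that of a
letter v and a letter z adjacent to v, which fixes the trivial coset. *)
Lemma letter_actC u z c d p : adj u z ->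
  letter_act (u, c) (letter_act (z, d) p) = letter_act (z, d) (letter_act (u, c) p).
Proof.
wlog zv : u z c d / z != v => [hw uz|uz].
  have [zv|zv] := eqVneq z v; last exact: hw.
  apply/esym/hw; last by rewrite adj_sym.
  by apply: contraTneq uz => ->; rewrite zv adj_irr.
rewrite /letter_act /= (negPf zv).
have [uv|_] := eqVneq u v; last first.
  rewrite -!map_comp; apply: eq_map => e /=; rewrite -!edge_transM.
  by rewrite (raag_letter_commute _ _ uz).
rewrite map_push; congr push; rewrite /edge_trans /= ltrans_full //.
by apply/full_subgroupP; rewrite rho_letter /= finset.inE -uv uz.
Qed.

Lemma word_act_eq w1 w2 p : raag_eq w1 w2 -> reduced p -> word_act w1 p = word_act w2 p.
Proof.
move=> w12; elim: w12 p => {w1 w2}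
  [w|w1 w2 _ IH|w1 w2 w3 _ IH1 _ IH2|w1 w2 w3 w4 _ IH1 _ IH2|u c|u z uz] p pr //.
- by rewrite IH.
- by rewrite IH1 // IH2.
- by rewrite !word_act_cat IH2 // IH1 //; apply: word_act_reduced.
- exact: letter_actK.
- rewrite /= (letter_actC (u := z)); last by rewrite adj_sym.
  by rewrite (letter_actK z false) ?(letter_actK u false) //; apply: letter_act_reduced.
Qed.

Definition tree_act g p := word_act (repr g) p.

Lemma tree_act_pi w p : reduced p -> tree_act (\pi_A w) p = word_act w p.
Proof. exact/word_act_eq/repr_raag_pi. Qed.

Lemma tree_act_reduced g p : reduced p -> reduced (tree_act g p).
Proof. exact: word_act_reduced. Qed.

Lemma tree_act1 p : reduced p -> tree_act 1 p = p.
Proof. by move=> pr; rewrite -[1]/(\pi_A [::]) tree_act_pi. Qed.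

Lemma tree_actM g h p : reduced p -> tree_act (g * h) p = tree_act g (tree_act h p).
Proof.
elim/quotW: g => w1; elim/quotW: h => w2 pr.
rewrite [_ * _]raag_piM (@tree_act_pi (w1 ++ w2)) // (@tree_act_pi w2) //.
by rewrite (@tree_act_pi w1) ?word_act_cat // word_act_reduced.
Qed.

Lemma tree_act_letter l p : reduced p -> tree_act (raag_letter l) p = letter_act l p.
Proof. exact: (@tree_act_pi [:: l]). Qed.

Definition tree_path g := tree_act g [::].

Lemma tree_path_reduced g : reduced (tree_path g).
Proof. exact: tree_act_reduced. Qed.
Hint Resolve tree_path_reduced : core.

Lemma tree_pathM g h : tree_path (g * h) = tree_act g (tree_path h).
Proof. exact: tree_actM. Qed.

Definition base_group : set A := full_subgroup (~: [set v])%SET.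

Lemma tree_act_base g p : base_group g -> reduced p ->
  tree_act g p = map (edge_trans g) p.
Proof.
move: g; apply: full_subgroup_ind => [|l g lv IHg] pr.
  by rewrite tree_act1 // -[LHS]map_id; apply: eq_map => e; rewrite edge_trans1.
rewrite tree_actM // tree_act_letter ?tree_act_reduced // IHg //.
move: lv; rewrite finset.in_setC1 /letter_act => /negPf ->.
by rewrite -map_comp; apply: eq_map => e; rewrite edge_transM.
Qed.

Lemma tree_path_base g : base_group g -> tree_path g = [::].
Proof. by move=> gv; rewrite /tree_path tree_act_base. Qed.

(** The edges that a path of an element of A_X can use; the representative b of
the coset can be taken in A_(X - v). *)
Definition edge_over X e :=
  exists b, full_subgroup (X :\ v)%SET b /\ e.1 = ltrans b edge_group.

Lemma tree_path_over X g e : full_subgroup X g -> e \in tree_path g -> edge_over X e.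
Proof.
move=> Xg; move: g Xg e; apply: full_subgroup_ind => [e|l g lX IHg e].
  by rewrite /tree_path tree_act1.
rewrite tree_pathM tree_act_letter // /letter_act; case: eqP => [_|/eqP lv].
  have base : edge_over X (edge_group, l.2).
    by exists 1; rewrite ltrans1; split=> //; apply: full_subgroup1.
  rewrite /push; case E: (tree_path g) => [|e' p].
    by rewrite mem_seq1 => /eqP ->.
  case: ifP => _; rewrite ?inE => eP; first by apply: IHg; rewrite E inE eP orbT.
  case/orP: eP => [/eqP -> //|eP].
  by apply: IHg; rewrite E inE.
case/mapP => e' /IHg[b [Xb e'b]] ->; exists (raag_letter l * b); split.
  apply: full_subgroupM => //; apply/full_subgroupP.
  by rewrite rho_letter !finset.inE lv lX.
by rewrite /= e'b ltransM.
Qed.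

(** The conjugate of v attached to a coset.  The representative chosen by [xget]
does not matter because [edge_group] commutes with v. *)
Definition edge_elt e : A := raag_letter (v, e.2) ^ (xget 1 e.1)^-1.

Lemma edge_eltE b c : edge_elt (ltrans b edge_group, c) = raag_letter (v, c) ^ b^-1.
Proof.
rewrite /edge_elt /=; case: xgetP => [_ _ [x Lx <-]|/(_ b)[]]; last first.
  by exists 1; rewrite ?mulg1 //; apply: full_subgroup1.
rewrite invgM conjgM; congr (_ ^ _).
have cx : commute (raag_letter (v, c)) x.
  apply: (@full_subgroup_commute _ [set v]%SET nbrs) => //; last first.
    by apply/full_subgroupP; rewrite rho_letter /= finset.inE eqxx.
  by move=> u z; rewrite !finset.inE => /eqP ->.
by apply/conjg_fixP/commgP/commuteV.
Qed.

Definition path_elt p : A := foldr (fun e g => edge_elt e * g) 1 p.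

Lemma path_elt_trans x p : (forall e, e \in p -> edge_over finset.setT e) ->
  path_elt (map (edge_trans x) p) = path_elt p ^ x^-1.
Proof.
elim: p => [|e p IHp] pX /=; first by rewrite conj1g.
rewrite conjMg IHp => [|e' e'p]; last by apply: pX; rewrite inE e'p orbT.
congr (_ * _); have [b [_ eb]] := pX e (mem_head _ _).
case: e eb {pX} => s c /= ->; rewrite edge_eltE /edge_trans /= -ltransM edge_eltE.
by rewrite invgM conjgM.
Qed.

(** The semidirect product decomposition of A: the path of g spells the component
of g in the kernel of the retraction onto [base_group]. *)
Lemma tree_path_decomp g : g = path_elt (tree_path g) * rho (~: [set v])%SET g.
Proof.
elim/raag_ind: g => [|l g IHg]; first by rewrite rho1 /tree_path tree_act1 // mulg1.
rewrite rhoM rho_letter finset.in_setC1 tree_pathM tree_act_letter // /letter_act.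
have pX e : e \in tree_path g -> edge_over finset.setT e.
  by apply: tree_path_over; apply/full_subgroupP; rewrite rhoT.
case: eqP => [lv|_] /=; last first.
  rewrite path_elt_trans // {1}IHg conjgE invgK.
  by rewrite !mulgA mulgVK.
rewrite mul1g {1}IHg mulgA; congr (_ * _).
have baseE c : edge_elt (edge_group, c) = raag_letter (v, c).
  by rewrite -{1}[edge_group]ltrans1 edge_eltE invg1 conjg1.
case: l lv => u c /= ->; rewrite /push; case E: (tree_path g) => [|e p] /=.
  by rewrite baseE.
case: eqP => [-> |_] /=; last by rewrite baseE.
by rewrite baseE raag_letterV mulVKg.
Qed.

Lemma tree_path_nil g : tree_path g = [::] -> base_group g.
Proof.
move=> g0; apply/full_subgroupP.
by rewrite [RHS]tree_path_decomp g0 mul1g.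
Qed.

Lemma lcp_map (f : set A * bool -> set A * bool) p q : injective f ->
  lcp (map f p) (map f q) = lcp p q.
Proof. by move=> fI; elim: p q => [|e p IHp] [|e' q] //=; rewrite (inj_eq fI) IHp. Qed.

(** Left multiplication by a generator is an automorphism of the Cayley tree of a
free group; the only case to check is a cancellation in exactly one of the two
words. *)
Lemma letter_act_dist l p q : reduced p -> reduced q ->
  tree_dist (letter_act l p) (letter_act l q) = tree_dist p q.
Proof.
rewrite /letter_act; case: ifP => _; last first.
  by rewrite /tree_dist !size_map lcp_map //; apply: edge_trans_inj.
move: (edge_group, l.2) => e.
(* A cancellation in the first word only: there is no common prefix before and
   after. *)
have half e' p' r : e' == edge_flip e -> reduced (e' :: p') ->
    (if r is f :: _ then f == edge_flip e else false) = false ->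
    tree_dist p' (e :: r) = tree_dist (e' :: p') r.
  move=> /eqP -> p'r rne; rewrite /tree_dist.
  have -> : lcp p' (e :: r) = 0.
    by case: p' p'r => [//|f p'] /= /andP[]; rewrite edge_flipK => /negPf ->.
  have -> : lcp (edge_flip e :: p') r = 0.
    by case: r rne => [//|f r] /=; rewrite eq_sym => ->.
  by rewrite /= addnS.
rewrite /push; case: p => [|e' p]; case: q => [|f q] pr qr //.
- by rewrite /tree_dist /= eqxx.
- case: ifP => fe; last by rewrite /tree_dist /= eqxx /=; lia.
  by rewrite tree_distC (half f) // tree_distC.
- case: ifP => fe; last by rewrite /tree_dist /= eqxx /=; lia.
  exact: half.
case: ifP => ee; case: ifP => fe.
- by rewrite (eqP ee) (eqP fe) /tree_dist /= eqxx; lia.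
- exact: half.
- by rewrite tree_distC (half f) // tree_distC.
- by rewrite /tree_dist /= eqxx; lia.
Qed.

Lemma tree_act_dist g p q : reduced p -> reduced q ->
  tree_dist (tree_act g p) (tree_act g q) = tree_dist p q.
Proof.
move=> pr qr; elim/raag_ind: g => [|l g IHg]; first by rewrite !tree_act1.
by rewrite !tree_actM // !tree_act_letter ?letter_act_dist ?tree_act_reduced.
Qed.

Definition tree_length g := size (tree_path g).

Lemma tree_length_dist x y :
  length_dist tree_length x y = tree_dist (tree_path x) (tree_path y).
Proof.
rewrite -(tree_act_dist x^-1) // -!tree_pathM mulVg.
by rewrite /length_dist /tree_length {2}/tree_path tree_act1 // /tree_dist /= subn0.
Qed.

Lemma tree_length_lyndon : lyndon_length tree_length.
Proof.
split=> [|x|x y z w]; first by rewrite /tree_length /tree_path tree_act1.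
  rewrite -[x^-1]mulg1 -/(length_dist tree_length x 1) tree_length_dist.
  rewrite tree_distC /tree_path tree_act1 // /tree_dist /= subn0.
  by rewrite /tree_length /tree_path.
by rewrite !tree_length_dist; apply: tree_dist4.
Qed.

Lemma tree_length0 g : tree_length g = 0 -> base_group g.
Proof. by move=> /size0nil; apply: tree_path_nil. Qed.

End Tree.

(** * Axes in the tree of a vertex *)

Section Axis.
Variables (Gam : simplicialGraph) (v : Gam).
Local Notation A := (raag Gam).
Implicit Types (U W X Z : {set Gam}) (g h x y b : A).
Implicit Types (e : set A * bool) (p q : seq (set A * bool)).
Local Notation L := (tree_length v).
Local Notation P := (tree_path v).

Lemma edge_flip_neq e : (e == edge_flip e) = false.
Proof. by case: e => s c; apply/negbTE/eqP => -[]; case: c. Qed.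

Lemma edge_step e p : edge_over v finset.setT e -> reduced (e :: p) ->
  tree_act v (edge_elt v e)^-1 (e :: p) = p.
Proof.
case: e => s c [b [bv /= ->]] epr; rewrite edge_eltE -conjVg conjgE invgK.
have {bv} bv : base_group v b.
  by apply: full_subgroupS bv; apply/fintype.subsetP => z; rewrite !finset.inE andbT.
have pr : reduced p by apply: path_sorted epr.
rewrite !tree_actM ?tree_act_reduced //.
rewrite (tree_act_base (full_subgroupV bv)) // -raag_letterV.
rewrite tree_act_letter ?map_reduced // /letter_act /= eqxx.
rewrite /edge_trans /= -ltransM mulVg ltrans1 /push /edge_flip /= negbK eqxx.
rewrite (tree_act_base bv) ?map_reduced // -map_comp -[RHS]map_id.
by apply: eq_map => e /=; rewrite -edge_transM mulgV edge_trans1.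
Qed.

Lemma tree_path_edge e : edge_over v finset.setT e -> P (edge_elt v e) = [:: e].
Proof.
move=> eT; rewrite /tree_path -[X in tree_act v _ X](@edge_step e [::]) // -tree_actM //.
by rewrite mulgV tree_act1.
Qed.

Lemma edge_overT g e : e \in P g -> edge_over v finset.setT e.
Proof. by apply: tree_path_over; apply/full_subgroupP; rewrite rhoT. Qed.

Lemma letter_sq c : raag_letter (v, c) * raag_letter (v, c) <> 1.
Proof.
move=> /(congr1 P); rewrite tree_pathM /tree_path !tree_act_letter ?letter_act_reduced //.
by rewrite /letter_act eqxx /push edge_flip_neq tree_act1.
Qed.

Lemma raag_gen_neq1 : raag_gen v <> 1.
Proof. by move=> v1; have := @letter_sq true; rewrite raag_letterE v1 mulg1. Qed.

(** A path with a single edge determines the sign of the exponent of v, so g and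
g^-1 cannot have the same one: A acts on the tree without inversions. *)
Lemma rho_edge g e : P g = [:: e] -> rho [set v]%SET g = raag_letter (v, e.2).
Proof.
move=> Pg; have eT : edge_over v finset.setT e by apply: (@edge_overT g); rewrite Pg mem_head.
rewrite (tree_path_decomp v g) Pg /= mulg1 rhoM rho_rho finset.setICr rho0 mulg1.
case: eT => b [bv eb]; case: e {Pg} eb => s c /= ->.
rewrite edge_eltE rhoJ rho_letter finset.inE eqxx rhoV.
rewrite -(iffLR (full_subgroupP _ b) bv) rho_rho (_ : _ :&: _ = finset.set0)%SET ?rho0.
  by rewrite invg1 conjg1.
by apply/finset.setP => z; rewrite !finset.inE; case: eqP.
Qed.

(** If g * g is shorter than expected, the paths from the base point to its images
under g and g^-1 share their first edge.  Conjugating by the element c attached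
to this edge then shortens g by 2, unless g inverts the edge. *)
Lemma cyclically_reduced_sq g : 0 < L g -> (forall h, L g <= L (g ^ h)) ->
  L (g * g) = (L g + L g)%N.
Proof.
move=> g_gt0 gmin.
have LL := tree_length_lyndon v.
have dP x y : length_dist L x y = tree_dist (P x) (P y) by exact: tree_length_dist.
have -> : L (g * g) = length_dist L g^-1 g by rewrite /length_dist invgK.
have szV : size (P g^-1) = size (P g) by exact: (lyndonV LL g).
rewrite dP /tree_dist szV -/(tree_length v g).
case: (posnP (lcp (P g^-1) (P g))) => [->|]; first by rewrite subn0.
case EV: (P g^-1) => [//|e' q]; case E: (P g) => [//|e p] /=; case: eqP => // e'e _.
move: EV; rewrite {}e'e {e'} => EV; exfalso.
have eT : edge_over v finset.setT e by apply: (@edge_overT g); rewrite E mem_head.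
(* A path of size 1 shared by g and g^-1 would be inverted by g. *)
have [p0|p_gt0] := posnP (size p).
  have q0 : size q = 0 by move: szV; rewrite EV E /= p0; case.
  move: E EV; rewrite (size0nil p0) (size0nil q0) => /rho_edge E /rho_edge.
  by rewrite rhoV E => lV; apply: (@letter_sq e.2); rewrite -{1}lV mulVg.
pose c := edge_elt v e; have Pc : P c = [:: e] by exact: tree_path_edge.
have qp : size q = size p by move: szV; rewrite EV E /=; case.
have d1 x : length_dist L 1 x = L x by rewrite /length_dist invg1 mul1g.
have := gmin c; have := lyndon4 LL 1 g c (g * c).
have -> : length_dist L 1 (g * c) = length_dist L g^-1 c.
  by rewrite d1 /length_dist invgK.
have -> : length_dist L c (g * c) = L (g ^ c) by [].
have -> : length_dist L g (g * c) = L c by rewrite /length_dist mulKg.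
rewrite !d1 !dP EV E Pc /tree_dist /= !eqxx /= /tree_length E Pc /=.
have -> : lcp q [::] = 0 by case: (q).
by lia.
Qed.

(** Conjugating g to minimal length, either g fixes the base point or the base
point lies on the axis of g. *)
Lemma axis g : exists h, L (g ^ h) = 0 \/
  0 < L (g ^ h) /\ forall k, L ((g ^+ k) ^ h) = (k * L (g ^ h)%g)%N.
Proof.
have exm : exists m, `[< exists h, L (g ^ h) = m >].
  by exists (L (g ^ 1)%g); apply/asboolP; exists 1.
case: (ex_minnP exm) => m /asboolP[h Lh] hmin; exists h.
case: (posnP (L (g ^ h))) => [->|gh0]; [by left | right; split=> // k].
rewrite conjXg; apply: lyndon_pow => //; first exact: tree_length_lyndon.
apply: cyclically_reduced_sq => // h'; rewrite Lh; apply: hmin; apply/asboolP.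
by exists (h * h'); rewrite conjgM.
Qed.
End Axis.

(** * Parabolic subgroups *)

Section Parabolic.
Variables (Gam : simplicialGraph).
Local Notation A := (raag Gam).
Implicit Types (U W X Y Z : {set Gam}) (g h x y b : A) (P Q M : set A).

Definition conj_full U g : set A := [set x ^ g | x in full_subgroup U].

Lemma conj_fullP U g x : conj_full U g x <-> full_subgroup U (x ^ g^-1).
Proof.
split=> [[y Uy <-]|Ux]; first by rewrite conjgK.
by exists (x ^ g^-1) => //; rewrite conjgKV.
Qed.

Lemma conj_full1 U : conj_full U 1 = full_subgroup U.
Proof.
by apply/seteqP; split=> x; rewrite conj_fullP invg1 conjg1.
Qed.

(** If u is in U and not in W, the retraction onto A_u kills every conjugate of
A_W and no conjugate of u. *)
Lemma conj_full_subset U W g h : conj_full U g `<=` conj_full W h -> U \subset W.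
Proof.
move=> UW; apply/fintype.subsetP => u uU; apply: contraPT (@raag_gen_neq1 _ u) => uW.
have /UW : conj_full U g (raag_gen u ^ g).
  by exists (raag_gen u) => //; apply/full_subgroupP; rewrite rho_gen uU.
rewrite conj_fullP => /full_subgroupP/(congr1 (rho [set u]%SET)).
rewrite rho_rho (_ : _ :&: _ = finset.set0)%SET ?rho0; last first.
  by apply/finset.setP => z; rewrite !finset.inE; case: eqP => [->|//]; rewrite (negPf uW).
rewrite !rhoJ rho_gen finset.inE eqxx => /esym/eqP.
by rewrite !conjg_eq1 => /eqP u1; rewrite u1.
Qed.

(** If A_U ^ k is contained in A_U, then conjugation by k agrees on A_U with
conjugation by [rho U k], which preserves A_U. *)
Lemma conj_full_same U g h : conj_full U g `<=` conj_full U h ->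
  conj_full U h `<=` conj_full U g.
Proof.
move=> gh x; rewrite !conj_fullP => Ux.
pose k := g * h^-1.
have kP y : full_subgroup U y -> y ^ k = y ^ rho U k.
  move=> Uy; have /gh : conj_full U g (y ^ g) by exists y.
  by rewrite conj_fullP -conjgM => /full_subgroupP; rewrite rhoJ (iffLR (full_subgroupP _ _) Uy).
pose y := (x ^ h^-1) ^ (rho U k)^-1.
have Uy : full_subgroup U y.
  apply: full_subgroupJ => //; apply: full_subgroupV; exact: rho_in.
suff -> : x ^ g^-1 = y by [].
apply: (conjg_inj k); rewrite (kP y Uy) /y conjgKV /k.
by rewrite -!conjgM mulKg.
Qed.

(** The parabolic subgroups of A_X; the induction on X needs the conjugator to
stay in A_X. *)
Definition parabolic_in X P : Prop :=
  exists U g, [/\ U \subset X, full_subgroup X g & P = conj_full U g].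

Lemma parabolic_inS X Y P : X \subset Y -> parabolic_in X P -> parabolic_in Y P.
Proof.
move=> XY [U [g [UX Xg ->]]]; exists U, g; split=> //.
  exact: fintype.subset_trans XY.
exact: full_subgroupS Xg.
Qed.

Lemma parabolic_in_full X U : U \subset X -> parabolic_in X (full_subgroup U).
Proof.
by move=> UX; exists U, 1; split; rewrite ?conj_full1 //; apply: full_subgroup1.
Qed.

Lemma parabolic_in_conj X P g : full_subgroup X g -> parabolic_in X P ->
  parabolic_in X [set x | P (x ^ g^-1)].
Proof.
move=> Xg [U [h [UX Xh ->]]]; exists U, (h * g); split=> //.
  exact: full_subgroupM.
by apply/seteqP; split=> x /=; rewrite !conj_fullP invgM conjgM.
Qed.

Lemma ltrans_fix (v : Gam) x b :
  ltrans x (ltrans b (edge_group v)) = ltrans b (edge_group v) <->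
  edge_group v (x ^ b).
Proof.
split=> [xb|Lx].
  have : ltrans b (edge_group v) (x * b).
    by rewrite -xb; exists b => //; exists 1; rewrite ?mulg1 //; apply: full_subgroup1.
  by case=> y Ly bxb; rewrite conjgE -bxb mulKg.
by rewrite -ltransM conjgC ltransM ltrans_full.
Qed.

Lemma edge_stab_parabolic v X e : edge_over v X e ->
  parabolic_in (X :\ v) [set x | full_subgroup (X :\ v)%SET x /\ edge_trans x e = e].
Proof.
case: e => s c [b [Yb /= ->]]; exists (nbrs v :&: (X :\ v))%SET, b^-1; split.
- exact: finset.subsetIr.
- exact: full_subgroupV.
apply/seteqP; split=> x; rewrite conj_fullP invgK /=.
  move=> [Yx [/ltrans_fix Lx]]; apply: full_subgroupI => //.
  exact: full_subgroupJ.
move=> H; have Lx : edge_group v (x ^ b).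
  by apply: full_subgroupS H; apply: finset.subsetIl.
have Yx : full_subgroup (X :\ v)%SET (x ^ b).
  by apply: full_subgroupS H; apply: finset.subsetIr.
split; last by rewrite /edge_trans /= (iffRL (ltrans_fix v x b)).
by rewrite -[x](conjgK b); apply: full_subgroupJ => //; apply: full_subgroupV.
Qed.

(** If x and y = x ^ g^-1 are in A_Z, then y fixes the base point, so x fixes the
image of the base point under g^-1, and with it each edge on the way.
Conversely, an element that fixes these edges commutes with the kernel component
of g^-1, so that conjugating it by g^-1 amounts to conjugating it by the
component in A_(X - v). *)
Lemma path_stab v X Z g : Z \subset X -> v \in X -> v \notin Z -> full_subgroup X g ->
  full_subgroup Z `&` conj_full Z g =
  full_subgroup Z `&` conj_full Z (rho (X :\ v) g) `&`
    [set x | forall e, e \in tree_path v g^-1 ->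
                       full_subgroup (X :\ v)%SET x /\ edge_trans x e = e].
Proof.
move=> ZX vX vZ Xg; set Y := (X :\ v)%SET; set h := g^-1.
have ZY : Z \subset Y.
  by apply/fintype.subsetP => z zZ; rewrite !finset.inE (fintype.subsetP ZX) // andbT;
     apply: contraNneq vZ => <-.
have Yv : Y \subset (~: [set v])%SET.
  by apply/fintype.subsetP => z; rewrite !finset.inE; case/andP.
have Yh : rho (~: [set v])%SET h = (rho Y g)^-1.
  rewrite -rhoV -/h -{1}(iffLR (full_subgroupP X h) (full_subgroupV Xg)) rho_rho.
  by congr rho; apply/finset.setP => z; rewrite !finset.inE.
have ZB x : full_subgroup Z x -> base_group v x.
  by apply: full_subgroupS; apply: fintype.subset_trans Yv.
apply/seteqP; split=> x /=; rewrite !conj_fullP -/h.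
  move=> [Zx Zxh].
  have Zx_Y : rho Y x = x by apply/full_subgroupP; apply: full_subgroupS Zx.
  split; first split=> //.
    rewrite -rhoV -{1}Zx_Y -rhoJ.
    by rewrite (iffLR (full_subgroupP Y _) (full_subgroupS ZY Zxh)).
  move=> e eh; split; first exact/full_subgroupP.
  have : map (edge_trans x) (tree_path v h) = map id (tree_path v h).
    rewrite map_id -(tree_act_base (ZB _ Zx)) ?tree_path_reduced // -tree_pathM conjgC tree_pathM.
    by rewrite (tree_path_base (ZB _ Zxh)).
  by move/eq_in_map => /(_ e eh).
move=> [[Zx Zxb] fix_h]; split=> //.
have kx : commute (path_elt v (tree_path v h)) x^-1.
  apply/commgP/conjg_fixP; rewrite -path_elt_trans; last exact: edge_overT.
  by congr path_elt; rewrite -[RHS]map_id; apply/eq_in_map => e /fix_h[_].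
suff -> : x ^ h = x ^ (rho Y g)^-1 by [].
rewrite (tree_path_decomp v h) Yh conjgM; congr (_ ^ _).
by apply/conjg_fixP/commgP; rewrite -[x]invgK; apply/commute_sym/commuteV.
Qed.

(** An element x of the intersection and its conjugate y = x ^ g^-1 satisfy
x = [rho U y] ^ [rho U g] and y = [rho W x] ^ [rho W g]^-1, so that both are
conjugate to elements of A_Z by elements that only depend on g. *)
Lemma full_conj_retract X U W g : U \subset X -> W \subset X -> full_subgroup X g ->
  let Z := (U :&: W)%SET in exists k l, [/\ full_subgroup X k, full_subgroup X l &
    full_subgroup U `&` conj_full W g =
    [set x | (full_subgroup Z `&` conj_full Z l) (x ^ k^-1)]].
Proof.
move=> UX WX Xg Z; set k := rho U g; set q := rho W g.
have Uk : full_subgroup U k by exact: rho_in.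
have Wq : full_subgroup W q by exact: rho_in.
have Xk := full_subgroupS UX Uk; have Xq := full_subgroupS WX Wq.
have ZU : Z \subset U by exact: finset.subsetIl.
have ZW : Z \subset W by exact: finset.subsetIr.
exists k, (q^-1 * g * k^-1); split=> //.
  by do !apply: full_subgroupM => //; apply: full_subgroupV.
have lE x : (x ^ k^-1) ^ (q^-1 * g * k^-1)^-1 = (x ^ g^-1) ^ q.
  by rewrite -!conjgM !invgM !invgK mulKg.
apply/seteqP; split=> x /=; rewrite !conj_fullP lE.
  move=> [Ux Wx]; split.
    have -> : x ^ k^-1 = rho U (x ^ g^-1).
      by rewrite rhoJ rhoV (iffLR (full_subgroupP _ _) Ux).
    exact: rho_full.
  have -> : (x ^ g^-1) ^ q = rho W x.
    by rewrite -(iffLR (full_subgroupP _ _) Wx) !rhoJ !rhoV conjgKV.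
  by rewrite /Z finset.setIC; apply: rho_full.
move=> [Zx Zxg]; split.
  by rewrite -[x](conjgKV k); apply: full_subgroupJ => //; apply: full_subgroupS Zx.
rewrite -[x ^ g^-1](conjgK q); apply: full_subgroupJ; last exact: full_subgroupV.
exact: full_subgroupS Zxg.
Qed.

Lemma parabolic_in_stab v X P (s : seq (set A * bool)) :
  (forall Q R, parabolic_in (X :\ v) Q -> parabolic_in (X :\ v) R ->
     parabolic_in (X :\ v) (Q `&` R)) ->
  (forall e, e \in s -> edge_over v X e) ->
  parabolic_in (X :\ v) P ->
  parabolic_in (X :\ v) (P `&` [set x | forall e, e \in s ->
                       full_subgroup (X :\ v)%SET x /\ edge_trans x e = e]).
Proof.
move=> capI; elim: s => [|e s IHs] sX PX.
  rewrite (_ : [set x | _] = setT) ?setIT //.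
  by apply/seteqP; split.
have {IHs} IH : parabolic_in (X :\ v) (P `&` [set x | forall e, e \in s ->
                       full_subgroup (X :\ v)%SET x /\ edge_trans x e = e]).
  by apply: IHs => // e' e's; apply: sX; rewrite inE e's orbT.
have := capI _ _ IH (edge_stab_parabolic (sX e (mem_head _ _))).
congr parabolic_in; rewrite -setIA; congr (_ `&` _).
apply/seteqP; split=> x /=.
  by move=> [sx ex] e'; rewrite inE => /orP[/eqP ->|/sx].
by move=> sx; split=> [e' e's|]; apply: sx; rewrite inE ?e's ?orbT ?eqxx.
Qed.

(** By induction on X.  After [full_conj_retract] the two subgroups are A_Z and
A_Z ^ l.  If Z = X they are equal, and otherwise [path_stab] moves the
intersection to X - v for some v outside Z. *)
Theorem parabolic_in_cap X P Q :
  parabolic_in X P -> parabolic_in X Q -> parabolic_in X (P `&` Q).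
Proof.
have [n] := ubnP #|X|; elim: n => // n IHn in X P Q *.
rewrite ltnS => Xn [U [g [UX Xg ->]]] [W [h [WX Xh ->]]].
have Xhg : full_subgroup X (h * g^-1) by apply: full_subgroupM => //; apply: full_subgroupV.
rewrite (_ : _ `&` _ = [set x | (full_subgroup U `&` conj_full W (h * g^-1)) (x ^ g^-1)]); last first.
  by apply/seteqP; split=> x /=; rewrite !conj_fullP -!conjgM invgM invgK mulKg.
apply: parabolic_in_conj => //.
have [k [l [Xk Xl ->]]] := full_conj_retract UX WX Xhg.
apply: parabolic_in_conj => //.
move: (U :&: W)%SET (fintype.subset_trans (finset.subsetIl U W) UX) => Z ZX.
have [XZ|] := boolP (X \subset Z).
  have -> : Z = X by apply/eqP; rewrite finset.eqEsubset ZX.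
  rewrite (_ : _ `&` _ = full_subgroup X); first exact: parabolic_in_full.
  apply/seteqP; split=> x; first by case.
  move=> Xx; split=> //; apply/conj_fullP.
  by apply: full_subgroupJ => //; apply: full_subgroupV.
case/subsetPn => v vX vZ.
have Yn : #|(X :\ v)%SET| < n by move: Xn; rewrite (finset.cardsD1 v) vX.
have ZY : Z \subset (X :\ v)%SET by rewrite finset.subsetD1 ZX vZ.
rewrite (path_stab ZX vX vZ Xl).
apply: (parabolic_inS (finset.subD1set X v)); apply: parabolic_in_stab.
- by move=> Q1 Q2; apply: IHn.
- by move=> e; apply: tree_path_over; apply: full_subgroupV.
apply: IHn => //; first exact: parabolic_in_full.
exists Z, (rho (X :\ v)%SET l); split=> //; exact: rho_in.
Qed.

(** Among the parabolic subgroups that contain M, one with the fewest generators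
is the smallest: by [conj_full_same] its intersection with any other one cannot
be smaller. *)
Theorem parabolic_closure M : exists U g, M `<=` conj_full U g /\
  forall W h, M `<=` conj_full W h -> conj_full U g `<=` conj_full W h.
Proof.
have fullT x : full_subgroup finset.setT x by apply/full_subgroupP; rewrite rhoT.
have exm : exists m, `[< exists U g, #|U| = m /\ M `<=` conj_full U g >].
  exists #|finset.setT : {set Gam}|; apply/asboolP; exists finset.setT, 1; split=> // x _.
  exact/conj_fullP.
case: (ex_minnP exm) => m /asboolP[U [g [Um Mg]]] minm.
exists U, g; split=> // W h Mh.
have pT (V : {set Gam}) (k : A) : parabolic_in finset.setT (conj_full V k).
  by exists V, k; split=> //; exact: fullT.
have [Z [k [_ _ capE]]] := parabolic_in_cap (pT U g) (pT W h).
have ZU : Z \subset U.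
  by apply: (@conj_full_subset _ _ k g); rewrite -capE => x [].
have ZE : Z = U.
  apply/eqP; rewrite finset.eqEcard ZU Um; apply: minm; apply/asboolP.
  by exists Z, k; split=> //; rewrite -capE => x Mx; split; [apply: Mg|apply: Mh].
have : conj_full U g `<=` conj_full U k.
  by apply: conj_full_same; rewrite -{1}ZE -capE => x [].
by rewrite -{2}ZE -capE => UW x /UW[].
Qed.

Lemma mem_link U (z : Gam) : reflect (forall u, u \in U -> adj u z) (z \in link U).
Proof.
apply: (iffP finset.bigcapP) => Uz u /Uz; by rewrite finset.inE.
Qed.

(** Composing the retractions that omit one vertex outside Z gives [rho Z]. *)
Lemma full_of_omitted Z g :
  (forall w, w \notin Z -> rho (~: [set w])%SET g = g) -> full_subgroup Z g.
Proof.
move=> Zg; suff H (s : seq Gam) : (forall w, w \in s -> w \notin Z) ->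
    rho (~: [set:: s])%SET g = g.
  apply/full_subgroupP; rewrite -{2}(H (enum (~: Z)%SET)).
    by congr rho; apply/finset.setP => z; rewrite !finset.inE mem_enum finset.inE negbK.
  by move=> w; rewrite mem_enum finset.inE.
elim: s => [|w s IHs] sZ.
  by rewrite -{2}[g]rhoT; congr rho; apply/finset.setP => z; rewrite !finset.inE.
rewrite -{2}IHs => [|w' w's]; last by apply: sZ; rewrite inE w's orbT.
rewrite -{2}(Zg w); last by apply: sZ; exact: mem_head.
rewrite rho_rho; congr rho; apply/finset.setP => z.
by rewrite !finset.inE negb_or andbC.
Qed.

(** Let w be a vertex outside U that is not adjacent to some u in U.  Since u
and its conjugate by g, which is u, fix the base point of the tree of w, the
generator u fixes the path of g.  But u is in no conjugate of [edge_group w], so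
this path is empty and g does not involve w. *)
Lemma centralizer_full U g : (forall u, u \in U -> commute (raag_gen u) g) ->
  full_subgroup (U :|: link U) g.
Proof.
move=> Ug; apply: full_of_omitted => w; rewrite finset.inE negb_or => /andP[wU wl].
have [u uU uw] : exists2 u, u \in U & ~~ adj u w.
  by apply/exists_inP; apply: contraNT wl; rewrite negb_exists_in => /forall_inP H;
     apply/mem_link => u /H; rewrite negbK.
apply/full_subgroupP; apply: tree_path_nil.
have Bu : base_group w (raag_gen u).
  apply/full_subgroupP; rewrite rho_gen finset.in_setC1 ifT //.
  by apply: contraNneq wU => <-.
have : map (edge_trans (raag_gen u)) (tree_path w g) = map id (tree_path w g).
  rewrite map_id -(tree_act_base Bu) ?tree_path_reduced // -tree_pathM (Ug u uU) tree_pathM.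
  by rewrite (tree_path_base Bu).
move/eq_in_map; case E: (tree_path w g) => [//|e p] /(_ e (mem_head _ _)) eu.
have [b [_ eb]] : edge_over w finset.setT e by apply: (@edge_overT _ _ g); rewrite E mem_head.
case: e eb eu {E} => s c /= -> [] /ltrans_fix/full_subgroupP/(congr1 (rho [set u]%SET)).
rewrite rho_rho (_ : _ :&: _ = finset.set0)%SET ?rho0; last first.
  by apply/finset.setP => z; rewrite !finset.inE; case: eqP => [->|//];
     rewrite adj_sym (negPf uw).
rewrite !rhoJ rho_gen finset.inE eqxx => /esym/eqP.
by rewrite conjg_eq1 => /eqP/raag_gen_neq1.
Qed.

(** On A_U, conjugation by g agrees with conjugation by [rho U g], so
g * (rho U g)^-1 centralizes A_U. *)
Lemma normalizer_full U g : (forall x, full_subgroup U x -> full_subgroup U (x ^ g)) ->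
  full_subgroup (U :|: link U) g.
Proof.
move=> Ug; rewrite -(mulgVK (rho U g) g); apply: full_subgroupM; last first.
  exact: (full_subgroupS (finset.subsetUl U (link U)) (@rho_in _ U g)).
apply: centralizer_full => u uU.
have Uu : full_subgroup U (raag_gen u) by apply/full_subgroupP; rewrite rho_gen uU.
apply/commgP/conjg_fixP; rewrite conjgM.
rewrite -(iffLR (full_subgroupP _ _) (Ug _ Uu)) rhoJ (iffLR (full_subgroupP _ _) Uu).
exact: conjgK.
Qed.

Lemma normalizer_conj_full U g h :
  (forall x, conj_full U g x -> conj_full U g (x ^ h)) ->
  conj_full (U :|: link U) g h.
Proof.
move=> Ugh; apply/conj_fullP; apply: normalizer_full => x Ux.
have /Ugh/conj_fullP : conj_full U g (x ^ g) by exists x.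
by congr full_subgroup; rewrite !conjgE !invgM !invgK !mulgA.
Qed.

End Parabolic.

(** * Irreducible sets of vertices *)

(** Used to compare powers of two elements with translation lengths p and q. *)
Lemma absz_cross (p q : int) :
  (Posz (absz q) * p - Posz (absz p) * q = 0)%R \/
  (Posz (absz q) * p + Posz (absz p) * q = 0)%R.
Proof. by case: p => p; case: q => q /=; lia. Qed.

Section Rigidity.
Variables (Gam : simplicialGraph).
Local Notation A := (raag Gam).
Implicit Types (U W X Y Z : {set Gam}) (f g h n s x y b : A) (P Q M N T : set A).

(** For M contained in A_X, this says that the parabolic closure of M is A_X; the
formulation is invariant under conjugation of M. *)
Definition spans X M : Prop :=
  forall U g, M `<=` conj_full U g -> X \subset U.

(** No partition of X into two nonempty sets that are joined by all possible
edges. *)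
Definition irreducible X : Prop :=
  forall U, U \subset X -> X \subset U :|: link U -> U = finset.set0 \/ U = X.

(** If M ^ t is contained in M, then M lies in P ^ t^-1 for each parabolic subgroup
P that contains M; so the smallest such P is contained in P ^ t^-1, and t lies in
the normalizer of P. *)
Lemma normalized_closure X T M U g : spans X T ->
  (forall t x, T t -> M x -> M (x ^ t)) ->
  M `<=` conj_full U g ->
  (forall W h, M `<=` conj_full W h -> conj_full U g `<=` conj_full W h) ->
  X \subset U :|: link U.
Proof.
move=> XT TM MU minU; apply: (XT _ g) => t Tt; apply: normalizer_conj_full => x Ux.
have /minU : M `<=` conj_full U (g * t^-1).
  move=> y My; apply/conj_fullP; rewrite invgM invgK conjgM.
  by apply/conj_fullP/MU/TM.
by move=> /(_ x Ux)/conj_fullP; rewrite invgM invgK conjgM => /conj_fullP.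
Qed.

Lemma full0 x : full_subgroup finset.set0 x -> x = 1.
Proof. by move=> /full_subgroupP <-; rewrite rho0. Qed.

Lemma conj_full0 g x : conj_full finset.set0 g x -> x = 1.
Proof. by move=> /conj_fullP/full0/eqP; rewrite conjg_eq1 => /eqP. Qed.

(** If A_U ^ g is the parabolic closure of M, then X is the join of U and its
complement, which leaves U empty or equal to X. *)
Lemma irreducible_normalized X T M : irreducible X -> spans X T ->
  (forall t x, T t -> M x -> M (x ^ t)) -> M `<=` full_subgroup X ->
  (forall x, M x -> x = 1) \/ spans X M.
Proof.
move=> irrX XT TM MX; have [U [g [MU minU]]] := parabolic_closure M.
have UX : U \subset X.
  by apply: (@conj_full_subset _ _ _ g 1); apply: minU; rewrite conj_full1.
have XU := normalized_closure XT TM MU minU.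
case: (irrX U UX XU) => UE; [left=> x /MU|right=> W h /minU/conj_full_subset].
  by rewrite UE => /conj_full0.
by rewrite UE.
Qed.

Lemma irreducible_commute X x y : irreducible X -> spans X [set x] ->
  commute x y -> full_subgroup X y -> y = 1 \/ spans X [set y].
Proof.
move=> irrX Xx xy Xy.
case: (@irreducible_normalized X [set x] [set y] irrX Xx) => [t z -> ->|z -> //|y1|]; first 2 last.
- by right.
- by apply/conjg_fixP/commgP/commute_sym.
- by left; apply: y1.
Qed.

Lemma not_spans_base (X : {set Gam}) v x h : v \in X -> base_group v (x ^ h) ->
  ~ spans X [set x].
Proof.
move=> vX xv Xx; have /Xx : [set x] `<=` conj_full (~: [set v])%SET h^-1.
  by move=> _ ->; apply/conj_fullP; rewrite invgK.
by move=> /fintype.subsetP/(_ v vX); rewrite !finset.inE eqxx.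
Qed.

(** Taking v in the support of the parabolic closure of f, no conjugate of f fixes
the base point of the tree of v, so f acts as a nontrivial translation on an
axis. *)
Lemma involution_trivial f : f * f = 1 -> f = 1.
Proof.
move=> ff; have [U [g [fU minU]]] := parabolic_closure [set f].
case: (finset.set_0Vmem U) => [U0|[v vU]].
  by move: fU; rewrite U0 => /(_ f erefl)/conj_full0.
have Uf : spans U [set f] by move=> W h /minU/conj_full_subset.
have [h [Lf0|[Lf Lk]]] := axis v f.
  by case: (@not_spans_base _ _ _ _ vU (tree_length0 Lf0)).
have := Lk 2; rewrite expg2 ff conj1g (lyndon1 (tree_length_lyndon v)); lia.
Qed.

(** An element a of A_X that commutes with n and has translation length 0 fixes a
vertex of the tree of v, so its parabolic closure is smaller than A_X; by
irreducibility, it is trivial. *)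
Lemma translation_length X n v : irreducible X -> v \in X -> spans X [set n] ->
  exists (L : A -> nat) (tau : A -> int),
  [/\ lyndon_length L,
      0 < L n /\ (forall k, L (n ^+ k) = (k * L n)%N),
      forall a b : A, commute n a -> commute n b -> tau (a * b) = (tau a + tau b)%R,
      forall a : A, commute n a -> L a = absz (tau a)
    & forall a : A, commute n a -> full_subgroup X a -> tau a = 0%R -> a = 1].
Proof.
move=> irrX vX Xn; have [h [Ln0|[Ln Lk]]] := axis v n.
  by case: (@not_spans_base _ _ _ _ vX (tree_length0 Ln0)).
have LL := lyndon_conj h (tree_length_lyndon v).
have [tau [tauM tauL]] := translation_hom LL Ln Lk.
exists (fun x => tree_length v (x ^ h)), tau; split=> // a na Xa ta.
have [//|Xspan] := irreducible_commute irrX Xn na Xa.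
have := tauL a na; rewrite ta => /tree_length0 av.
by case: (@not_spans_base _ _ _ _ vX av).
Qed.

Lemma irreducible_centralizer_abelian X n a b : irreducible X -> X != finset.set0 ->
  spans X [set n] -> full_subgroup X a -> full_subgroup X b ->
  commute n a -> commute n b -> commute a b.
Proof.
move=> irrX /finset.set0Pn[v vX] Xn Xa Xb na nb.
have [L [tau [_ _ tauM _ tau1]]] := translation_length irrX vX Xn.
have nab : commute n [~ a, b].
  by rewrite /commg conjgE; do !apply: commuteM => //; apply: commuteV.
have Xab : full_subgroup X [~ a, b].
  by apply: full_subgroupM; [exact: full_subgroupV | exact: full_subgroupJ].
apply/commgP/eqP/tau1 => //.
have aV := commuteV na; have bV := commuteV nb.
have nb' := commuteM na nb; have nb'' := commuteM bV nb'.
have tau0 : tau 1 = 0%R by have := tauM 1 1 (commute1 n) (commute1 n); rewrite mulg1; lia.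
have := tauM _ _ na aV; have := tauM _ _ nb bV; rewrite !mulgV tau0.
rewrite /commg conjgE (tauM a^-1) // (tauM b^-1) // (tauM a) //.
move: (tau a) (tau b) (tau a^-1) (tau b^-1) => p q p' q'; lia.
Qed.

(** Since [L] is subadditive, conjugation by f changes the length of [s ^+ k] by at
most 2 * L f; comparing growth rates, s and s ^ f have the same translation
length up to sign.  Equal signs give s ^ f = s by injectivity.  For opposite
signs, a = f * f commutes with s and f, and a power of a equals s ^+ j or its
inverse; conjugation by f fixes the former and inverts the latter, so j = 0,
a = 1, and f = 1. *)
Lemma irreducible_conj_commute X s f : irreducible X ->
  spans X [set s] -> full_subgroup X s -> full_subgroup X f ->
  commute s (s ^ f) -> s ^ f = s.
Proof.
move=> irrX Xs sX fX ssf.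
have [X0|/finset.set0Pn[v vX]] := eqVneq X finset.set0.
  by move: sX; rewrite X0 => /full0 ->; rewrite conj1g.
have [L [tau [LL [Ls Lk] tauM tauL tau1]]] := translation_length irrX vX Xs.
have ss : commute s s by [].
have sfX : full_subgroup X (s ^ f) by exact: full_subgroupJ.
have tau0 : tau 1 = 0%R by have := tauM 1 1 (commute1 s) (commute1 s); rewrite mulg1; lia.
have tauX a k : commute s a -> tau (a ^+ k) = (Posz k * tau a)%R.
  move=> sa; elim: k => [|k IHk]; first by rewrite GRing.mul0r.
  by rewrite expgS tauM // ?IHk; [rewrite intS GRing.mulrDl GRing.mul1r | exact: commuteX].
have Lsf : L (s ^ f) = L s.
  have LfV := lyndonV LL f; pose k := (L f + L f).+1.
  have Lsf_k : L ((s ^ f) ^+ k) = (k * L (s ^ f)%g)%N.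
    by rewrite !tauL ?tauX ?abszM //; exact: commuteX.
  (* The error 2 * L f is absorbed because k is larger than it. *)
  have cancel_k p q : k * p <= L f + L f + k * q -> p <= q.
    rewrite leqNgt => kpq; rewrite leqNgt; apply: contraNN kpq => qp.
    by apply: leq_trans (leq_mul (leqnn k) qp); rewrite mulnS addnC -addnS addnC leq_add2r.
  apply/eqP; rewrite eqn_leq; apply/andP; split; apply: cancel_k.
    rewrite -Lsf_k -Lk -conjXg conjgE.
    apply: leq_trans (lyndonM LL _ _) _; rewrite LfV -addnA leq_add2l addnC.
    exact: lyndonM LL _ _.
  rewrite -Lsf_k -Lk -{1}(conjgK f (s ^+ k)) conjXg conjgE invgK.
  apply: leq_trans (lyndonM LL _ _) _; rewrite -addnA leq_add2l addnC -[X in _ <= _ + X]LfV.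
  exact: lyndonM LL _ _.
have [tE|tN] : tau (s ^ f) = tau s \/ tau (s ^ f) = (- tau s)%R.
  by move: Lsf; rewrite !tauL //; lia.
- apply: divg1_eq; apply: tau1.
  + by apply: commuteM => //; apply: commuteV.
  + by apply: full_subgroupM => //; apply: full_subgroupV.
  have := tauM _ _ ss (commuteV ss); rewrite mulgV tau0 => sV0.
  by rewrite tauM //; [rewrite tE -sV0 | exact: commuteV].
have sfV : s ^ f = s^-1.
  rewrite -[s ^ f]invgK; congr _^-1; apply: mulg1_eq; apply: tau1.
  + exact: commuteM.
  + exact: full_subgroupM.
  by rewrite tauM // tN; lia.
pose a := f * f.
have sa : commute s a.
  by apply/commgP/conjg_fixP; rewrite /a conjgM sfV conjVg sfV invgK.
have aX : full_subgroup X a by exact: full_subgroupM.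
have af : a ^ f = a by apply/conjg_fixP/commgP; apply/commute_sym/commuteM.
pose j := absz (tau a); pose m := L s.
have mE : m = absz (tau s) by exact: tauL.
have key : s ^+ j = s ^- j.
  have sam : commute s (a ^+ m) by exact: commuteX.
  have ssj : commute s (s ^+ j) by exact: commuteX.
  have ssjV := commuteV ssj.
  have tV : tau (s ^- j) = (- (Posz j * tau s))%R.
    have := tauM _ _ ssj ssjV; rewrite mulgV tau0 tauX //.
    by move: (tau (s ^- j)) (Posz j * tau s)%R => p q; lia.
  have sjX : full_subgroup X (s ^+ j).
    by elim: (j) => [|i IHi]; rewrite ?expgS; [apply: full_subgroup1 | apply: full_subgroupM].
  have amX : full_subgroup X (a ^+ m).
    by elim: (m) => [|i IHi]; rewrite ?expgS; [apply: full_subgroup1 | apply: full_subgroupM].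
  have amf : (a ^+ m) ^ f = a ^+ m by rewrite conjXg af.
  have sjf : (s ^+ j) ^ f = s ^- j by rewrite conjXg sfV expVgn.
  have [eq1|eq1] : tau (a ^+ m / s ^+ j) = 0%R \/ tau (a ^+ m * s ^+ j) = 0%R.
  - by rewrite !tauM // tV !tauX // mE /j; exact: absz_cross.
  - have /divg1_eq E : a ^+ m / s ^+ j = 1.
      by apply: tau1 => //; [exact: commuteM | apply: full_subgroupM => //; exact: full_subgroupV].
    by rewrite -sjf -E amf.
  - have /mulg1_eq E : a ^+ m * s ^+ j = 1.
      by apply: tau1 => //; [exact: commuteM | apply: full_subgroupM].
    by rewrite -sjf -E conjVg amf.
have j0 : j = 0.
  have : L (s ^+ (j + j)) = 0 by rewrite expgnDr {2}key mulgV (lyndon1 LL).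
  by rewrite Lk; nia.
have /involution_trivial -> : f * f = 1 by apply: tau1 => //; apply/eqP; rewrite -absz_eq0; apply/eqP.
exact: conjg1.
Qed.

End Rigidity.

(** * Joins and the rigidity lemma *)

Section Join.
Variables (Gam : simplicialGraph).
Local Notation A := (raag Gam).
Implicit Types (U W X Y Z : {set Gam}) (f g h n s x y b : A) (P Q M N T : set A).

Definition joined U W : Prop := forall u w, u \in U -> w \in W -> adj u w.

Lemma joinedC U W : joined U W -> joined W U.
Proof. by move=> UW w u wW uU; rewrite adj_sym; apply: UW. Qed.

Lemma join_decomp U W g : joined U W -> full_subgroup (U :|: W) g ->
  g = rho U g * rho W g.
Proof.
move=> UW; move: g; apply: full_subgroup_ind => [|l g lUW IHg].
  by rewrite !rho1 mulg1.
have UWF : ~~ ((l.1 \in U) && (l.1 \in W)).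
  by apply/negP => /andP[lU lW]; have := UW _ _ lU lW; rewrite adj_irr.
rewrite !rhoM !rho_letter {1}IHg; move: lUW UWF; rewrite finset.inE.
case lU: (l.1 \in U); case lW: (l.1 \in W) => // _ _.
  by rewrite mul1g mulgA.
rewrite mul1g !mulgA; congr (_ * _); apply/commute_sym.
apply: (full_subgroup_commute UW (@rho_in _ U g)).
by apply/full_subgroupP; rewrite rho_letter lW.
Qed.

(** If the projection of N to A_U lies in A_V ^ g, with g in A_U, then N lies in the
conjugate by g of the full subgroup of V and W. *)
Lemma join_spans U W N : joined U W -> N `<=` full_subgroup (U :|: W) ->
  spans (U :|: W) N -> spans U [set rho U x | x in N].
Proof.
move=> UW NUW Nspan V g NV.
have UV : U :|: W \subset (V :&: U) :|: W.
  apply: (Nspan _ (rho U g)) => x Nx; apply/conj_fullP.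
  rewrite (join_decomp UW (NUW x Nx)) conjMg; apply: full_subgroupM.
    have /conj_fullP Vx : conj_full V g (rho U x) by apply: NV; exists x.
    have := @rho_full _ U _ _ Vx; rewrite rhoJ rhoV rho_rho finset.setIid.
    by apply: full_subgroupS; rewrite finset.setIC; apply: finset.subsetUl.
  have xg : commute (rho W x) (rho U g)^-1.
    apply: commuteV; apply/commute_sym.
    exact: full_subgroup_commute UW (@rho_in _ U g) (@rho_in _ W x).
  have -> : rho W x ^ (rho U g)^-1 = rho W x by exact/conjg_fixP/commgP.
  exact: (full_subgroupS (finset.subsetUr (V :&: U)%SET W) (@rho_in _ W x)).
apply/fintype.subsetP => u uU.
have : u \in (V :&: U) :|: W by apply: (fintype.subsetP UV); rewrite finset.inE uU.
rewrite !finset.inE uU andbT => /orP[//|uW].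
by have := UW u u uU uW; rewrite adj_irr.
Qed.

(** By induction on X.  If X is a join, all hypotheses pass to the projections to
the two factors.  If X is irreducible, s and s ^ f lie in the centralizer of a
nontrivial element of N, which is abelian, so they commute and
[irreducible_conj_commute] applies. *)
Lemma spanning_rigid X N s f : N `<=` full_subgroup X -> spans X N ->
  full_subgroup X s -> full_subgroup X f ->
  (forall x, N x -> commute x s) -> (forall x, N x -> commute x (s ^ f)) ->
  s ^ f = s.
Proof.
have [m] := ubnP #|X|; elim: m => // m IHm in X N s f *.
rewrite ltnS => Xm NX Nspan Xs Xf Ns Nsf.
have half U W : joined U W -> U :|: W = X -> #|U| < m -> rho U (s ^ f) = rho U s.
  move=> UW UWX Um; rewrite rhoJ; apply: (IHm U [set rho U x | x in N]) => //.
  - by move=> _ [x _ <-]; exact: rho_in.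
  - by apply: (join_spans UW); rewrite UWX.
  - exact: rho_in.
  - exact: rho_in.
  - by move=> _ [x Nx <-]; rewrite /commute -!rhoM (Ns x Nx).
  - by move=> _ [x Nx <-]; rewrite -rhoJ /commute -!rhoM (Nsf x Nx).
have [irrX|] := pselect (irreducible X).
  have [->|/eqP s_neq1] := eqVneq s 1; first exact: conj1g.
  have sspan : spans X [set s].
    case: (@irreducible_normalized _ X N [set s] irrX Nspan) => //.
    - by move=> x _ Nx ->; apply/conjg_fixP/commgP/commute_sym/Ns.
    - by move=> _ ->.
    - by move=> s1; case: s_neq1; apply: s1.
  apply: (irreducible_conj_commute irrX sspan Xs Xf).
  have [N1|nN1] := pselect (forall x, N x -> x = 1).
    have : X \subset finset.set0.
      by apply: (Nspan _ 1) => x /N1 ->; apply/conj_fullP; rewrite conj1g; apply: full_subgroup1.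
    by rewrite finset.subset0 => /eqP X0; move: Xs; rewrite X0 => /full0 /s_neq1.
  have [x [Nx x_neq1]] : exists x, N x /\ x <> 1.
    by apply: contra_notP nN1 => nex x Nx; apply: contra_notP nex => x1; exists x.
  have xspan : spans X [set x].
    by case: (irreducible_commute irrX sspan (commute_sym (Ns x Nx)) (NX x Nx)).
  have X_neq0 : X != finset.set0.
    by apply/eqP => X0; move: Xs; rewrite X0 => /full0 /s_neq1.
  apply: (irreducible_centralizer_abelian irrX X_neq0 xspan) => //; last 2 first.
  - exact: Ns.
  - exact: Nsf.
  exact: full_subgroupJ.
move=> nirr.
have [U [UX XU U0 UneqX]] :
    exists U, [/\ U \subset X, X \subset U :|: link U, U <> finset.set0 & U <> X].
  apply: contra_notP nirr => nex U UX XU.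
  by apply: contra_notP nex => /not_orP[U0 UneqX]; exists U.
pose W := (X :\: U)%SET.
have UW : joined U W.
  move=> u w uU; rewrite finset.inE => /andP[wU wX].
  have := fintype.subsetP XU _ wX; rewrite finset.inE (negPf wU) /= => /mem_link.
  exact.
have UWX : U :|: W = X.
  apply/finset.setP => z; rewrite !finset.inE; case zU: (z \in U) => //=.
  by rewrite (fintype.subsetP UX).
have Ulm : #|U| < m.
  apply: leq_trans Xm; apply: fintype.proper_card; rewrite finset.properEneq UX andbT.
  exact/eqP.
have Wlm : #|W| < m.
  apply: leq_trans Xm; rewrite finset.cardsD (finset.setIidPr UX).
  have := fintype.subset_leq_card UX; have : 0 < #|U| by rewrite finset.card_gt0; apply/eqP.
  lia.
have WUX : W :|: U = X by rewrite finset.setUC.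
have decomp g : full_subgroup X g -> g = rho U g * rho W g.
  by move=> Xg; apply: join_decomp => //; rewrite UWX.
rewrite [LHS]decomp; last exact: full_subgroupJ.
by rewrite [RHS]decomp // (half U W) // (half W U) //; exact: joinedC.
Qed.
End Join.

(** * Parabolic closures and centralizers *)

Lemma Pc_closure (Gam : simplicialGraph) (M : set (raag Gam)) U g :
  M `<=` conj_full U g ->
  (forall W h, M `<=` conj_full W h -> conj_full U g `<=` conj_full W h) ->
  Pc M = conj_full U g.
Proof.
move=> MU minU.
have minP : minimal_parabolic M (conj_full U g).
  split=> [||Q [W [h ->]] MW WU]; [by exists U, g | by [] | ].
  by apply/seteqP; split=> //; apply: minU.
have eqP Q : minimal_parabolic M Q -> conj_full U g = Q.
  move=> [[W [h ->]] MW minW].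
  by apply: minW => //; [exists U, g | apply: minU].
apply: xget_unique => [|Q [Qmin Quniq]]; first by split.
exact/esym/eqP.
Qed.

(** The default value of [Pc] is empty, so the hypothesis says that the whole group
is the only parabolic subgroup that contains M. *)
Lemma spans_of_Pc_total (Gam : simplicialGraph) (M : set (raag Gam)) :
  Pc (generated M) = setT -> spans finset.setT M.
Proof.
move=> PcT U g MU.
have [_ _ minT] : minimal_parabolic (generated M) setT.
  move: PcT; rewrite /Pc; case: xgetP => [P _ [Pmin _] PT|_ T0]; first by rewrite -PT.
  by have : (@setT (raag Gam)) 1 by []; rewrite -T0.
have genU : generated M `<=` conj_full U g.
  apply: smallest_sub => //; split=> [|x y|x]; rewrite ?conj_fullP.
  - by rewrite conj1g; apply: full_subgroup1.
  - by rewrite conjMg; apply: full_subgroupM.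
  - by rewrite conjVg; apply: full_subgroupV.
apply: (@conj_full_subset _ finset.setT U 1 g).
by rewrite (minT (conj_full U g)) //; exists U, g.
Qed.

Theorem proposition5p2 (Gam : simplicialGraph) (F : set (raag Gam))
  (t : raag Gam) (hF : subgroup F)
  (hG : Pc (generated (F `|` [set t])) = setT)
  (hN : normal_in (centralizer F t) F) :
  direct_factor (Pc (centralizer F t)) /\
  exists X : {set Gam},
    [/\ Pc (centralizer F t) = full_subgroup X,
        X :|: link X = finset.setT /\ X :&: link X = finset.set0,
        F `&` full_subgroup X = centralizer F t,
        ~: X = link X
      & quotient_embeds F (centralizer F t) (full_subgroup (~: X))].
Proof.
have [F1 FM FV] := hF; have [_ _ NJ] := hN.
set N := centralizer F t in hN NJ *.
have Tspan : spans finset.setT (F `|` [set t]) by exact: spans_of_Pc_total.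
have norm_N a x : (F `|` [set t]) a -> N x -> N (x ^ a).
  case=> [Fa Nx|-> [Fx xt]]; first exact: NJ.
  by rewrite (_ : x ^ t = x); [split | apply/conjg_fixP/commgP].
have [X [g [NX minX]]] := parabolic_closure N.
have XT : X :|: link X = finset.setT.
  by apply/eqP; rewrite -finset.subTset; apply: normalized_closure Tspan norm_N NX minX.
have X0 : X :&: link X = finset.set0.
  apply/finset.setP => z; rewrite !finset.inE; apply/negP => /andP[zX /mem_link/(_ z zX)].
  by rewrite adj_irr.
have linkX : ~: X = link X.
  apply/finset.setP => z; have := congr1 (fun S : {set Gam} => z \in S) XT.
  have := congr1 (fun S : {set Gam} => z \in S) X0.
  by rewrite !finset.inE; case: (z \in X); case: (z \in link X).
have XY : joined X (link X) by move=> u w uX /mem_link; exact.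
have decomp a : a = rho X a * rho (link X) a.
  by apply: join_decomp => //; apply/full_subgroupP; rewrite XT rhoT.
(* A_X is a direct factor, so it is equal to its conjugates. *)
have XE : conj_full X g = full_subgroup X.
  have gX x : full_subgroup X x -> x ^ g = x ^ rho X g.
    move=> Xx; rewrite {1}(decomp g) conjgM; apply/conjg_fixP/commgP.
    apply: (full_subgroup_commute XY) (@rho_in _ _ g).
    by apply: full_subgroupJ => //; exact: rho_in.
  have sub : conj_full X g `<=` full_subgroup X.
    by move=> _ [x Xx <-]; rewrite gX //; apply: full_subgroupJ => //; exact: rho_in.
  apply/seteqP; split=> //; rewrite -conj_full1.
  by apply: conj_full_same; rewrite conj_full1.
have {}NX : N `<=` full_subgroup X by rewrite -XE.
have PcN : Pc N = full_subgroup X by rewrite -XE; apply: Pc_closure; rewrite // XE.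
have Nspan : spans X N by move=> W h /minX/conj_full_subset.
(* Rigidity is applied to the component of t in A_X. *)
have FN : F `&` full_subgroup X = N.
  apply/seteqP; split=> [f [Ff Xf]|f Nf]; last by split; [case: Nf | apply: NX].
  have Xt : full_subgroup X (rho X t) by exact: rho_in.
  have tN x : N x -> commute x (rho X t).
    move=> Nx; have [_ xt] := Nx; have /full_subgroupP Xx := NX x Nx.
    by rewrite /commute -{1 2}Xx -!rhoM xt.
  have tf : rho X t ^ f = rho X t.
    apply: (spanning_rigid NX Nspan Xt Xf tN) => x Nx.
    have Nxf : N (x ^ f^-1) by apply: NJ => //; apply: FV.
    have := congr1 (fun y => y ^ f) (tN _ Nxf).
    by rewrite (conjMg (x ^ f^-1)) (conjMg (rho X t)) conjgKV.
  split=> //; rewrite (decomp t); apply: commuteM.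
    by apply/commute_sym/commgP/conjg_fixP.
  exact: full_subgroup_commute XY Xf (@rho_in _ _ t).
have rhoY_N x : N x -> rho (link X) x = 1.
  move=> /NX/full_subgroupP <-; rewrite rho_rho finset.setIC X0; exact: rho0.
split.
  rewrite PcN; exists (full_subgroup (link X)); split.
  - exact: generated_subgroup.
  - exact: generated_subgroup.
  - by move=> x y; apply: full_subgroup_commute.
  - apply/seteqP; split=> [x [Xx Yx]|_ ->]; last by split; apply: full_subgroup1.
    by apply: full0; rewrite -X0; apply: full_subgroupI.
  - move=> a; exists (rho X a), (rho (link X) a); split=> //; exact: rho_in.
exists X; split=> //; rewrite linkX.
have coset_rho f x : [set f * n | n in N] x -> rho (link X) x = rho (link X) f.
  by move=> [n Nn <-]; rewrite rhoM (rhoY_N n Nn) mulg1.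
have N1 : N 1 by split=> //; rewrite mul1g mulg1.
have coset_f f : [set f * n | n in N] f by exists 1; rewrite ?mulg1.
have rep f : rho (link X) (xget 1 [set f * n | n in N]) = rho (link X) f.
  by apply: coset_rho; apply: (xgetI _ (coset_f f)).
(* The embedding projects an arbitrary element of the coset to A_(link X). *)
exists (fun C => rho (link X) (xget 1 C)); split.
- by move=> C _; exact: rho_in.
- move=> C D [f _ <-] [f' _ <-]; rewrite !rep.
  set CD := set_mul _ _.
  have : CD (xget 1 CD).
    by apply: (@xgetI _ 1 CD (f * f')); exists f => //; exists f'.
  by case=> x /coset_rho fx [y /coset_rho fy <-]; rewrite rhoM fx fy.
move=> C D; rewrite !inE => -[f Ff <-] [f' Ff' <-].
rewrite !rep => ff'.
have Nff' : N (f^-1 * f').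
  rewrite -FN; split; first by apply: FM => //; apply: FV.
  by apply/full_subgroupP; rewrite [RHS]decomp (rhoM (link X)) rhoV ff' mulVg mulg1.
apply/seteqP; split=> _ [n Nn <-].
- exists ((f^-1 * f')^-1 * n); last by rewrite invgM invgK !mulgA mulgV mul1g.
  by case: hN => -[_ NM NV] _ _; apply: NM => //; apply: NV.
exists (f^-1 * f' * n); last by rewrite !mulgA mulgV mul1g.
by case: hN => -[_ NM NV] _ _; apply: NM.
Qed.
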